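(* Let $d,m\in\mathbb{N}$ with $m\ge2$, and let $\Phi$ be the $m$-adic multiscale system generated by a kernel $K$ with finite index sets $\Omega_n$, $n\ge m^d$, as defined in the context. Then $\Phi$ satisfies Assumption A (see context) with the polynomial-type bound $Q(x)=x^{\max\{1,d/2\}+1}$ and $\Gamma=\max\{1,d/2\}$. That is: all elements of $\Phi$ have unit $L^2$-norm; there is $c>0$ with $c\,n^{\max\{1,d/2\}}\le\#\Omega_n\le n^{\max\{1,d/2\}+1}$ for all $n\ge m^d$; and there is a constant $C>0$ such that for all $n\ge m^d$ and all $g\in L^\infty(\mathbb{T}^d)$ $$\|g\|_{B^{-d/2}_{\infty,\infty}}\le C\max_{(j,\bar k)\in\Omega_n}|\langle\phi_{j,\bar k},g\rangle|+C\,\frac{\|g\|_{L^\infty}}{\sqrt n}.$$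
   Context: Functions are $1$-periodic, i.e. defined on $\mathbb{T}^d=\mathbb{R}^d/\mathbb{Z}^d\simeq[0,1)^d$; $\langle\cdot,\cdot\rangle$ is the $L^2(\mathbb{T}^d)$ inner product; $\mathcal{F}[K](\xi)=\int_{\mathbb{R}^d}K(x)e^{-2\pi i\xi\cdot x}\,dx$. $m$-adic multiscale system: let $K\in C^\infty(\mathbb{R}^d)$ with $\operatorname{supp}K\subseteq[0,1)^d$, $|\mathcal{F}[K](\xi)|>0$ for $|\xi|<2$, $\|K\|_{L^2(\mathbb{R}^d)}=1$ and $\|K\|_{L^\infty(\mathbb{R}^d)}\le2$. For $j\in\mathbb{N}_0$ and $\bar k\in[0,1)^d$ let $\phi_{j,\bar k}$ be the function on $\mathbb{T}^d$ associated with the cube $B=\bar k+[0,m^{-j})^d$, namely (the periodization of) $z\mapsto|B|^{-1/2}K(|B|^{-1/d}(z-\bar k))=m^{jd/2}K(m^j(z-\bar k))$. For $n\ge m^d$ put $J=\lfloor\frac1d\frac{\log n}{\log m}\rfloor$, $R=J\max\{1,\frac d2\}$, $$\mathcal{D}_R=\{(k_1m^{-R},\dots,k_dm^{-R})\mid k_i\in\mathbb{Z},\ 0\le k_i\le m^R-1,\ i=1,\dots,d\},$$ $$\Omega_n=\{(j,\bar k)\mid j=0,\dots,J-1,\ \bar k\in\mathcal{D}_R\}.$$ $\Omega=\bigcup_{n\ge m^d}\Omega_n$ and $\Phi=\{\phi_{j,\bar k}\mid(j,\bar k)\in\Omega\}$. Besov norm: $\|g\|_{B^{-d/2}_{\infty,\infty}}=\sup_{j\ge0}\max_{k\in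 P_j^d,\,e\in E_j}|\langle\psi_{j,k,e},g\rangle|$, where $\{\psi_{j,k,e}\}$ is an $S$-regular periodized tensor-product orthonormal wavelet basis of $L^2(\mathbb{T}^d)$ with $S>\max\{1,d/2\}$, $P_j^d=\{0,\dots,2^j-1\}^d$, $E_0=\{0,1\}^d$, $E_j=\{0,1\}^d\setminus\{0\}$ for $j\ge1$ (different choices of basis give equivalent norms). Assumption A for a dictionary $\{\phi_\omega\mid\omega\in\Omega\}\subset L^2$ with $\Omega$ countable and finite subsets $\Omega_n\subset\Omega$: $\|\phi_\omega\|_{L^2}=1$ for all $\omega$; $c\,n^\Gamma\le\#\Omega_n\le Q(n)$ for all $n$, with $Q$ of polynomial growth and constants $c,\Gamma>0$; and $\|g\|_{B^{-d/2}_{\infty,\infty}}\le C\max_{\omega\in\Omega_n}|\langle\phi_\omega,g\rangle|+C\|g\|_{L^\infty}/\sqrt n$ for all $n$ and all $g\in L^\infty$, with $C$ independent of $n$ and $g$. *)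

(* Defs.v *)
From HB Require Import structures.
From mathcomp Require Import all_boot all_order all_algebra finmap.
From mathcomp Require Import complex.
From mathcomp Require Import all_classical all_reals all_analysis.

Set Implicit Arguments.
Unset Strict Implicit.
Unset Printing Implicit Defensive.

Import Order.TTheory GRing.Theory Num.Theory.
Import numFieldNormedType.Exports.

Local Open Scope classical_set_scope.
Local Open Scope ring_scope.

Section measurable_rV.
Context {R : realType} (n : nat).

Let coord (i : 'I_n) (x : 'rV[R]_n) : measurableTypeR R := x ord0 i.

Let rV_set0 : g_sigma_preimage coord set0.
Proof. exact: sigma_algebra0. Qed.

Let rV_setC A : g_sigma_preimage coord A -> g_sigma_preimage coord (~` A).
Proof. exact: sigma_algebraC. Qed.

Let rV_bigcup (F : (set 'rV[R]_n)^nat) :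
  (forall i, g_sigma_preimage coord (F i)) ->
  g_sigma_preimage coord (\bigcup_i F i).
Proof. exact: sigma_algebra_bigcup. Qed.

HB.instance Definition _ := @isMeasurable.Build default_measure_display
  'rV[R]_n (g_sigma_preimage coord) rV_set0 rV_setC rV_bigcup.

Lemma measurable_coord (i : 'I_n) :
  measurable_fun [set: 'rV[R]_n] (fun x => x ord0 i : measurableTypeR R).
Proof.
move=> _ Y mY; rewrite setTI; apply: sub_sigma_algebra => /=.
rewrite -bigcup_seq/=; exists i => /=; first by rewrite mem_index_enum.
by exists Y => //; rewrite setTI.
Qed.

Lemma measurable_fun_rV d (T : measurableType d) (f : T -> 'rV[R]_n) :
  (forall i, measurable_fun [set: T] (fun x => f x ord0 i : measurableTypeR R)) ->
  measurable_fun [set: T] f.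
Proof.
move=> mf; suff sub : g_sigma_preimage (fun i => coord i \o f) `<=` measurable.
  by move: sub; rewrite g_sigma_preimage_comp => sub _ A mA; apply: sub; exists A.
apply: smallest_sub; first exact: sigma_algebra_measurable.
elim/big_ind : _ => [//|A B mA mB|i _ _ [B mB <-]]; last exact: mf.
by move=> X [/mA|/mB].
Qed.

End measurable_rV.

Section lebesgue_rV_succ.
Context {R : realType} (n : nat).
Variable mu : {sigma_finite_measure set 'rV[R]_n -> \bar R}.

Let cons_rV (p : measurableTypeR R * 'rV[R]_n) : 'rV[R]_n.+1 :=
  \row_i (if unlift ord0 i is Some j then p.2 ord0 j else p.1).

Let uncons_rV (x : 'rV[R]_n.+1) : measurableTypeR R * 'rV[R]_n :=
  (x ord0 ord0, \row_j x ord0 (lift ord0 j)).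

Let cons_rVK : cancel cons_rV uncons_rV.
Proof.
move=> [t x]; rewrite /uncons_rV mxE unlift_none; congr pair.
by apply/rowP => j; rewrite !mxE liftK.
Qed.

Let measurable_cons_rV : measurable_fun setT cons_rV.
Proof.
apply: measurable_fun_rV => i; case: (unliftP ord0 i) => [j ->|->].
  apply: (eq_measurable_fun ((fun x : 'rV[R]_n => x ord0 j) \o snd)).
    by move=> -[t x] _; rewrite /cons_rV mxE liftK.
  by apply: measurableT_comp => //; exact: measurable_coord.
apply: (eq_measurable_fun fst) => // -[t x] _.
by rewrite /cons_rV mxE unlift_none.
Qed.

Let measurable_uncons_rV : measurable_fun setT uncons_rV.
Proof.
apply/measurable_fun_pairP; split; first exact: measurable_coord.
apply: measurable_fun_rV => i.
apply: (eq_measurable_fun (fun x : 'rV[R]_n.+1 => x ord0 (lift ord0 i))).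
  by move=> x _; rewrite /uncons_rV mxE.
exact: measurable_coord.
Qed.

Let cons_measure := pushforward (@lebesgue_measure R \x mu)%E cons_rV.

Let cons_measure0 : cons_measure set0 = 0%E.
Proof. by rewrite /cons_measure /pushforward preimage_set0 measure0. Qed.

Let cons_measure_ge0 A : (0 <= cons_measure A)%E.
Proof. exact: measure_ge0. Qed.

Let cons_measure_sigma_additive : semi_sigma_additive cons_measure.
Proof.
pose m : {measure set _ -> \bar R} := (@lebesgue_measure R \x mu)%E.
pose nu := measure_function_pushforward__canonical__measure_function_Measure
  m measurable_cons_rV.
exact: (@measure_semi_sigma_additive _ _ _ nu).
Qed.

Let cons_measure_sigma_finite : sigma_finite setT cons_measure.
Proof.
have /sigma_finiteP[F [TF ndF Foo]] := sigma_finiteT (@lebesgue_measure R).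
have /sigma_finiteP[G [TG ndG Goo]] := sigma_finiteT mu.
exists (fun k => uncons_rV @^-1` (F k `*` G k)).
  rewrite -preimage_bigcup (_ : \bigcup_k _ = setT) ?preimage_setT//.
  rewrite -setXTT TF TG predeqE => -[x y]; split.
    by move=> [k _ []/= ? ?]; split; exists k.
  move=> [/= [k _ Fkx] [l _ Gly]]; exists (maxn k l) => //; split.
  - by move: x Fkx; exact/subsetPset/ndF/leq_maxl.
  - by move: y Gly; exact/subsetPset/ndG/leq_maxr.
move=> k; have [mF Fk] := Foo k; have [mG Gk] := Goo k; split.
  rewrite -[X in measurable X]setTI; apply: measurable_uncons_rV => //.
  exact: measurableX.
rewrite /cons_measure /pushforward -comp_preimage (_ : _ \o _ = id).
  by rewrite preimage_id product_measure1E// lte_mul_pinfty// ge0_fin_numE.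
by apply/funext => x /=; rewrite cons_rVK.
Qed.

HB.instance Definition _ := isMeasure.Build _ _ _ cons_measure
  cons_measure0 cons_measure_ge0 cons_measure_sigma_additive.

HB.instance Definition _ := Measure_isSigmaFinite.Build _ _ _ cons_measure
  cons_measure_sigma_finite.

Definition lebesgue_rV_succ : {sigma_finite_measure set 'rV[R]_n.+1 -> \bar R} :=
  cons_measure.

End lebesgue_rV_succ.

Fixpoint lebesgue_rV {R : realType} (n : nat) :
    {sigma_finite_measure set 'rV[R]_n -> \bar R} :=
  if n is n'.+1 then lebesgue_rV_succ (lebesgue_rV n') else dirac (0 : 'rV[R]_0).

Lemma lebesgue_rV_prod {R : realType} (n : nat) (A : 'I_n -> set (measurableTypeR R)) :
  (forall i, measurable (A i)) ->
  lebesgue_rV n [set x : 'rV[R]_n | forall i, A i (x ord0 i)] =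
  (\prod_(i < n) lebesgue_measure (A i))%E.
Proof.
elim: n A => [|n IH] A mA.
  by rewrite big_ord0 /= diracE mem_set// => -[].
rewrite big_ord_recl -IH//= /pushforward.
rewrite -product_measure1E//.
  congr ((_ \x _)%E _); apply/seteqP; split=> -[t x] /=.
    move=> Ax; split; first by have := Ax ord0; rewrite mxE unlift_none.
    by move=> i; have := Ax (lift ord0 i); rewrite mxE liftK.
  by move=> [At Ax] i; rewrite mxE; case: unliftP => [j|] ->.
rewrite (_ : [set x | _] =
  \bigcap_i ((fun x : 'rV[R]_n => x ord0 i) @^-1` (A (lift ord0 i)))).
  apply: fin_bigcap_measurable => [|i _]; first exact: finite_finset.
  by rewrite -[X in measurable X]setTI; apply: measurable_coord.
by apply/seteqP; split=> x /= Ax i => [_|]; apply: Ax.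
Qed.

(* Points of R^d are row vectors. A function on the torus T^d = R^d / Z^d is a
   1-periodic function on R^d; integrals over T^d are integrals over [0,1)^d. *)
Section torus.
Context {R : realType} (d : nat).
Implicit Types (f g : 'rV[R]_d -> R) (x : 'rV[R]_d).

Definition unit_cube : set 'rV[R]_d := [set x | forall i, 0 <= x ord0 i < 1].

Lemma measurable_unit_cube : measurable unit_cube.
Proof.
rewrite (_ : unit_cube = \bigcap_i ((fun x => x ord0 i) @^-1` `[0, 1[%classic)).
  apply: fin_bigcap_measurable => [|i _]; first exact: finite_finset.
  by rewrite -[X in measurable X]setTI; exact: measurable_coord.
by apply/seteqP; split=> x /= x01 i; move: (x01 i); rewrite /= in_itv/= => ->.
Qed.

Definition torus_measure : {measure set 'rV[R]_d -> \bar R} :=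
  mrestr (lebesgue_rV d) measurable_unit_cube.

Definition periodic f := forall (l : 'rV[int]_d) x, f (x + map_mx intr l) = f x.

Definition torus_Lp (p : \bar R) : set ('rV[R]_d -> R) :=
  [set f | periodic f /\ f \in Lfun torus_measure p].

Definition torus_norm (p : \bar R) f : \bar R := ('N[torus_measure]_p[EFin \o f])%E.

Definition torus_inner f g : R := \int[torus_measure]_x (f x * g x).

(* sum over Z^d of the translates, meaningful when absolutely summable *)
Definition periodize f : 'rV[R]_d -> R := fun x =>
  let F (l : 'rV[int]_d) := (f (x + map_mx intr l))%:E in
  fine (\esum_(l in [set: 'rV[int]_d]) (F^\+ l)%E) -
  fine (\esum_(l in [set: 'rV[int]_d]) (F^\- l)%E).

End torus.
Arguments unit_cube {R} d.
Arguments torus_measure {R} d.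

Definition orthonormal_basis {R : realType} (dsp : measure_display)
    (T : measurableType dsp) (mu : {measure set T -> \bar R})
    (I : choiceType) (P : set I) (e : I -> T -> R) : Prop :=
  [/\ forall i, P i -> e i \in Lfun mu 2%:E,
      forall i j, P i -> P j -> \int[mu]_x (e i x * e j x) = (i == j)%:R &
      forall f, f \in Lfun mu 2%:E -> forall eps : R, 0 < eps ->
        exists (s : seq I) (c : I -> R), (forall i, i \in s -> P i) /\
          (Lnorm mu 2%:E (fun x => (f x - \sum_(i <- s) c i * e i x)%:E) < eps%:E)%E].

Section wavelet.
Context {R : realType}.
Implicit Types phi psi f : R -> R.

(* Meyer's r-regularity: C^r with all derivatives up to order r decaying
   faster than any power *)
Definition Cr_rapid_decay (r : nat) f : Prop :=
  [/\ forall l x, (l < r)%N -> derivable (derive1n l f) x 1,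
      continuous (derive1n r f) &
      forall l N, (l <= r)%N ->
        exists C : R, forall x, `|derive1n l f x| * (1 + `|x|) ^+ N <= C].

(* (None, k) indexes phi(x - k), (Some j, k) indexes 2^(j/2) psi(2^j x - k) *)
Definition line_wavelet phi psi (w : option nat * int) : R -> R := fun x =>
  if w.1 is Some j then Num.sqrt (2 ^+ j) * psi (2 ^+ j * x - w.2%:~R)
  else phi (x - w.2%:~R).

(* line_basis makes phi the scaling function of a multiresolution analysis with
   wavelet psi; the vanishing moments are then implied by regularity and
   orthonormality, and are listed as part of the usual definition *)
Record regular_wavelet_pair (r : nat) phi psi : Prop := {
  regular_scaling : Cr_rapid_decay r phi ;
  regular_wavelet : Cr_rapid_decay r psi ;
  vanishing_moments : forall l, (l < r)%N ->
    \int[@lebesgue_measure R]_x (x ^+ l * psi x) = 0 ;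
  line_basis : orthonormal_basis (@lebesgue_measure R)
    [set: option nat * int] (line_wavelet phi psi) }.

Variable d : nat.

(* (j, k, e) with k in P_j^d and e in E_j *)
Definition wavelet_index : set (nat * {ffun 'I_d -> nat} * {ffun 'I_d -> bool}) :=
  fun w => let: (j, k, e) := w in
    (forall i, (k i < 2 ^ j)%N) /\ ((0 < j)%N -> exists i, e i).

Definition torus_wavelet phi psi
    (w : nat * {ffun 'I_d -> nat} * {ffun 'I_d -> bool}) : 'rV[R]_d -> R :=
  let: (j, k, e) := w in
  periodize (fun x => 2 `^ (j%:R * d%:R / 2) *
    \prod_(i < d) (if e i then psi else phi) (2 ^+ j * x ord0 i - (k i)%:R)).

Definition regular_torus_wavelet_basis (r : nat) phi psi : Prop :=
  regular_wavelet_pair r phi psi /\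
  orthonormal_basis (torus_measure d) wavelet_index (torus_wavelet phi psi).

(* norm of the Besov space of smoothness -d/2 and integrability (oo, oo) *)
Definition besov_norm phi psi (g : 'rV[R]_d -> R) : \bar R :=
  ereal_sup [set `|torus_inner (torus_wavelet phi psi w) g|%:E | w in wavelet_index].

End wavelet.
Arguments regular_torus_wavelet_basis {R} d r phi psi.

Definition polynomial_growth {R : realType} (Q : R -> R) : Prop :=
  exists (a : R) (p : nat), forall x, 1 <= x -> `|Q x| <= a * x ^+ p.

Record assumptionA {R : realType} (d : nat)
    (besov : ('rV[R]_d -> R) -> \bar R) (I : choiceType) (Omega : set I)
    (n0 : nat) (Omega_ : nat -> set I) (phi : I -> 'rV[R]_d -> R)
    (Gamma : R) (Q : R -> R) : Prop := {
  index_countable : countable Omega ;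
  index_finite : forall n, (n0 <= n)%N ->
    finite_set (Omega_ n) /\ Omega_ n `<=` Omega ;
  dictionary_normalized : forall w, Omega w ->
    torus_Lp 2%:E (phi w) /\ torus_norm 2%:E (phi w) = 1%:E ;
  index_growth_exponent : 0 < Gamma ;
  index_growth_bound : polynomial_growth Q ;
  index_growth : exists2 c : R, 0 < c & forall n, (n0 <= n)%N ->
    c * n%:R `^ Gamma <= (#|` fset_set (Omega_ n)|)%:R <= Q n%:R ;
  besov_control : exists2 C : R, 0 < C & forall n, (n0 <= n)%N ->
    forall g, torus_Lp +oo%E g ->
    (besov g <=
      (C * \big[Num.max/0%R]_(w <- fset_set (Omega_ n)) `|torus_inner (phi w) g|)%:E
      + (C / Num.sqrt n%:R)%:E * torus_norm +oo%E g)%E }.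

Section multiscale.
Context {R : realType} (d : nat).
Implicit Types (K : 'rV[R]_d -> R) (x xi : 'rV[R]_d).

Definition iter_partial (s : seq 'I_d) (f : 'rV[R]_d -> R) : 'rV[R]_d -> R :=
  foldr (fun i h => 'D_(delta_mx ord0 i) h) f s.

Definition smooth (f : 'rV[R]_d -> R) : Prop := forall s : seq 'I_d,
  continuous (iter_partial s f) /\
  forall (i : 'I_d) x, derivable (iter_partial s f) x (delta_mx ord0 i).

Definition dot x xi : R := \sum_(i < d) x ord0 i * xi ord0 i.

Definition fourier K xi : R[i] :=
  Complex (\int[lebesgue_rV d]_x (K x * cos (- (2 * pi * dot xi x))))
          (\int[lebesgue_rV d]_x (K x * sin (- (2 * pi * dot xi x)))).

Record multiscale_kernel K : Prop := {
  kernel_smooth : smooth K ;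
  kernel_support : closure [set x | K x != 0] `<=` unit_cube d ;
  kernel_fourier : forall xi, Num.sqrt (dot xi xi) < 2 -> 0 < `|fourier K xi| ;
  kernel_norm2 : ('N[lebesgue_rV d]_2%:E[EFin \o K] = 1)%E ;
  kernel_normoo : ('N[lebesgue_rV d]_+oo[EFin \o K] <= 2%:E)%E }.

Variable m : nat.

(* w = (j, k) stands for the cube B = k + [0, m^-j)^d, so |B| = m^(-jd) *)
Definition multiscale_atom K (w : nat * 'rV[R]_d) : 'rV[R]_d -> R :=
  periodize (fun z => m%:R `^ (w.1%:R * d%:R / 2) * K (m%:R ^+ w.1 *: (z - w.2))).

Definition scale_count (n : nat) : nat :=
  Num.truncn (d%:R^-1 * (ln n%:R / ln m%:R) : R).

Definition grid_exponent (n : nat) : R := (scale_count n)%:R * Num.max 1 (d%:R / 2).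

(* r and m ^ r need not be integers *)
Definition grid (r : R) : set 'rV[R]_d :=
  [set x | exists k : 'I_d -> int, forall i,
    [/\ (0 <= k i)%R, (k i)%:~R <= m%:R `^ r - 1 &
        x ord0 i = (k i)%:~R * m%:R `^ (- r)]].

Definition multiscale_index_ (n : nat) : set (nat * 'rV[R]_d) :=
  [set w | (w.1 < scale_count n)%N /\ grid (grid_exponent n) w.2].

Definition multiscale_index : set (nat * 'rV[R]_d) :=
  \bigcup_(n in [set n | (m ^ d <= n)%N]) multiscale_index_ n.

End multiscale.
Arguments multiscale_atom {R d} m K w.
Arguments multiscale_index_ {R} d m n.
Arguments multiscale_index {R} d m.

(* Main.v *)
Require Import Defs.
From mathcomp Require Import all_boot all_order all_algebra finmap.
From mathcomp Require Import complex.
From mathcomp Require Import all_classical all_reals all_analysis.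
From mathcomp Require Import measurable_realfun ess_sup_inf ring lra.

Set Implicit Arguments.
Unset Strict Implicit.
Unset Printing Implicit Defensive.

Import Order.TTheory GRing.Theory Num.Theory.
Import numFieldNormedType.Exports.

Local Open Scope classical_set_scope.
Local Open Scope ring_scope.

Local Notation periodic := Defs.periodic.

(** The two counting bounds and the normalization are direct. The index set
    is a product of the scales [j < J] with a grid of [p ^ d] points, where [p]
    is the integer part of [m ^ (J max (1, d / 2))], and [m ^ (J d) <= n < m ^
    ((J + 1) d)]; an atom is the periodization of a rescaled copy of [K] whose
    integer translates have disjoint supports, so it keeps the norm of [K].

    The content is the bound on the Besov norm, that is, on each wavelet
    coefficient [<psi, g>]. Unfolding the torus ([torus_inner_periodize])
    turns it into the integral over R^d of [F g], where [F] is a tensor product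
    of dilated one-dimensional wavelets at frequency [rho = 2 ^ i].

    The Fourier condition at [xi = 0] says that [int K <> 0].
    Let [k_j] be [K] dilated by [m ^ j] and normalized to mean one. Since the
    correlation of [k_j] with [g] at [z] is a multiple of the coefficient of
    [g] against the atom [(j, z)], Fubini ([inner_convolve],
    [mean_kernel_coef]) gives
    [int F g = int F(z) const <phi_(j,z), g> dz + int (F - k_j * F) g].
    So [F] may be replaced by its residual [F - k_j * F] at a cost that the
    atoms of scale [j] control ([inner_residual]). Because [k_j] has mean one,
    the residual is an average of first differences of [F] with steps at most
    [m ^ - j]; if [F] has [S] bounded differences at scale [rho], then [S]
    successive residuals gain the factor [(rho / m ^ j) ^ S]
    ([residuals_gain]).

    These eliminations run over the scales [j0, j0 + q, j0 + 2 q, ...], with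
    [m ^ j0] comparable to [rho], up to [J]. Each block of residuals may also
    lose a constant factor [A ^ S] in the size of the differences, and
    choosing [q] so large that [m ^ q >= 4 A ^ (2 S)] makes the gain beat this
    loss: as [2 S >= d + 1], the contributions of the successive scales decay
    like [2 ^ - l] ([scale_decay], [scale_bound_height]). What remains beyond
    the scale [J] is at most a multiple of [m ^ (- J d / 2)], hence of
    [n ^ (- 1 / 2)], times the sup norm of [g] ([coefficient_bound]).

    Finally the supremum over all positions [z] is replaced by the maximum
    over the grid. As [K] is Lipschitz with bounded support, moving [z] by the
    mesh [m ^ - R] changes the coefficient by [O(m ^ (j (1 - d / 2) - R))]
    times the sup norm of [g]; the choice [R = J max (1, d / 2)] is what makes
    this [O(n ^ (- 1 / 2))] for every [j < J] ([grid_error],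
    [atom_coef_sup]). *)

(** * Lebesgue measure on R^n under affine maps *)

Lemma lebesgue_measure_affine {R : realType} (a b : R) (A : set R) : 0 < a ->
  measurable (A : set (measurableTypeR R)) ->
  lebesgue_measure ((fun x => a * x + b) @^-1` A) =
    (a^-1%:E * lebesgue_measure A)%E.
Proof.
move=> a0 mA.
have mf : measurable_fun setT (fun x : measurableTypeR R => a * x + b : measurableTypeR R).
  by apply: measurable_funD => //; apply: measurable_funM.
pose nu := measure_function_pushforward__canonical__measure_function_Measure
  (@lebesgue_measure R) mf.
pose k : {nonneg R} := NngNum (ltW a0).
have := @lebesgue_measure_unique R (mscale k nu) _ A mA.
rewrite /mscale/= /pushforward => -> //.
  by rewrite muleA -EFinM mulVf ?mul1e// gt_eqF.
move=> _ [[u v] _ <-].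
rewrite /mscale/= /pushforward.
rewrite (_ : _ @^-1` _ = `](u - b) / a, (v - b) / a]%classic); last first.
  apply/seteqP; split => x /=; rewrite !in_itv/= ltr_pdivrMr// ler_pdivlMr//;
    by rewrite ltrBlDr lerBrDr mulrC.
rewrite !lebesgue_measure_itv/= !lte_fin ltr_pM2r ?invr_gt0// ltrD2r.
case: ifPn => uv; rewrite ?mule0//.
by rewrite -EFinM -EFinD; congr EFin; field; rewrite gt_eqF.
Qed.

Section measure_rV.
Context {R : realType} (n : nat).
Implicit Types (x y b : 'rV[R]_n).

(** Boxes with arbitrary Borel sides: they are stable under intersection
    and generate the Borel sets, so they determine a measure. *)
Definition rV_box (A : 'I_n -> set (measurableTypeR R)) : set 'rV[R]_n :=
  [set x | forall i, A i (x ord0 i)].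

Lemma measurable_rV_box A : (forall i, measurable (A i)) -> measurable (rV_box A).
Proof.
move=> mA; rewrite (_ : rV_box A =
  \bigcap_i ((fun x : 'rV[R]_n => x ord0 i) @^-1` (A i))).
  apply: fin_bigcap_measurable => [|i _]; first exact: finite_finset.
  by rewrite -[X in measurable X]setTI; exact: measurable_coord.
by apply/seteqP; split=> x /= Ax i => [_|]; apply: Ax.
Qed.

Definition rV_boxes : set (set 'rV[R]_n) :=
  [set B | exists2 A, (forall i, measurable (A i)) & B = rV_box A].

Lemma measurable_rV_boxes : (@measurable _ 'rV[R]_n) = <<s rV_boxes >>.
Proof.
apply/seteqP; split; last first.
  apply: smallest_sub; first exact: sigma_algebra_measurable.
  by move=> _ [A mA ->]; exact: measurable_rV_box.
apply: smallest_sub; first exact: smallest_sigma_algebra.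
elim/big_ind : _ => [//|A B sA sB X [/sA|/sB]//|i _ _ [B mB <-]].
apply: sub_gen_smallest; exists (fun j => if j == i then B else setT).
  by move=> j; case: ifPn.
apply/seteqP; split => [x [_ Bx] j|x Bx]; first by case: eqP => // ->.
by split => //; have := Bx i; rewrite eqxx.
Qed.

Lemma lebesgue_rV_unique (mu : {measure set 'rV[R]_n -> \bar R}) :
  (forall A, (forall i, measurable (A i)) ->
    mu (rV_box A) = (\prod_(i < n) lebesgue_measure (A i))%E) ->
  forall B, measurable B -> lebesgue_rV n B = mu B.
Proof.
move=> muE B mB.
apply: (measure_unique rV_boxes
  (fun k => rV_box (fun _ => `[- k%:R, k%:R]%classic))) => //.
- exact: measurable_rV_boxes.
- move=> _ _ [A mA ->] [A' mA' ->]; exists (fun i => A i `&` A' i).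
    by move=> i; exact: measurableI.
  by apply/seteqP; split=> x; [move=> [Ax A'x] i; split|
    move=> h; split=> i; have [] := h i].
- by move=> k; exists (fun=> `[- k%:R, k%:R]%classic).
- apply/seteqP; split => // x _.
  exists (Num.bound `|x|) => // i; rewrite /= in_itv/= -ler_norml ltW//.
  apply: (le_lt_trans _ (archi_boundP (normr_ge0 x))).
  rewrite {2}/Num.norm/= mx_normrE.
  exact: (le_bigmax _ (fun i : 'I_1 * 'I_n => `|x i.1 i.2|) (ord0, i)).
- by move=> _ [A mA ->]; rewrite muE//; exact: lebesgue_rV_prod.
- move=> k; have /= := @lebesgue_rV_prod R n (fun=> `[- k%:R, k%:R]%classic).
  rewrite /rV_box => ->//.
  rewrite ltey_eq; apply/orP; left.
  elim/big_ind : _ => // [x y fx fy|i _]; first exact: fin_numM.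
  by rewrite lebesgue_measure_itv/=; case: ifP.
Qed.

Lemma measurable_affine (a : R) b : measurable_fun setT (fun x => a *: x + b).
Proof.
apply: measurable_fun_rV => i.
rewrite (_ : (fun _ => _) = (fun x : 'rV[R]_n => a * x ord0 i + b ord0 i)).
  apply: measurable_funD => //; apply: measurable_funM => //.
  exact: measurable_coord.
by apply/funext => x; rewrite !mxE.
Qed.

(** Both sides are measures in [B], and on boxes the identity is the
    one-dimensional one in each coordinate. *)
Lemma lebesgue_rV_affine (a : R) b (B : set 'rV[R]_n) : 0 < a -> measurable B ->
  lebesgue_rV n ((fun x => a *: x + b) @^-1` B) =
  ((a ^- n)%:E * lebesgue_rV n B)%E.
Proof.
move=> a0 mB.
pose nu := measure_function_pushforward__canonical__measure_function_Measure
  (lebesgue_rV n) (measurable_affine a b).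
have an0 : 0 <= a ^+ n by rewrite exprn_ge0// ltW.
pose k : {nonneg R} := NngNum an0.
rewrite (@lebesgue_rV_unique (mscale k nu) _ B mB)/mscale/= /pushforward.
  by rewrite muleA -EFinM mulVf ?mul1e// expf_neq0// gt_eqF.
move=> A mA; rewrite /mscale/= /pushforward.
rewrite (_ : _ @^-1` _ =
    rV_box (fun i => (fun t => a * t + b ord0 i) @^-1` A i)); last first.
  by apply/seteqP; split=> x /= Ax i; have := Ax i; rewrite /= !mxE.
have /= := @lebesgue_rV_prod R n (fun i => (fun t => a * t + b ord0 i) @^-1` A i).
rewrite /rV_box => ->; last first.
  move=> i; rewrite -[X in measurable X]setTI.
  have /(_ measurableT) : measurable_fun setT
      (fun x : measurableTypeR R => a * x + b ord0 i : measurableTypeR R).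
    by apply: measurable_funD => //; apply: measurable_funM.
  exact.
under eq_bigr do rewrite lebesgue_measure_affine//.
rewrite big_split/= muleA.
rewrite prodEFin prodr_const card_ord -EFinM exprVn.
by rewrite divff ?mul1e// expf_neq0// gt_eqF.
Qed.

Lemma ge0_integral_rV_affine (a : R) b (f : 'rV[R]_n -> \bar R) : 0 < a ->
  measurable_fun setT f -> (forall x, 0 <= f x)%E ->
  (\int[lebesgue_rV n]_x f (a *: x + b)%R
   = (a ^- n)%:E * \int[lebesgue_rV n]_x f x)%E.
Proof.
move=> a0 mf f0.
have an0 : 0 <= a ^- n by rewrite invr_ge0 exprn_ge0// ltW.
pose k : {nonneg R} := NngNum an0.
rewrite -(@ge0_integral_mscale _ _ _ _ setT measurableT k f)//.
have := @ge0_integral_pushforward _ _ _ _ R _ (measurable_affine a b)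
  (lebesgue_rV n) setT f measurableT mf.
rewrite preimage_setT => <-; last by move=> ? _.
pose nu := measure_function_pushforward__canonical__measure_function_Measure
  (lebesgue_rV n) (measurable_affine a b).
apply: (@eq_measure_integral _ _ _ setT (mscale k (lebesgue_rV n)) nu) => A mA _.
exact: lebesgue_rV_affine.
Qed.

End measure_rV.

(** * Borel structure of R^n *)

Section norm_rV.
Context {R : realType} (n : nat).
Implicit Types (x y b : 'rV[R]_n).

Lemma coord_le_norm x i : `|x ord0 i| <= `|x|.
Proof.
rewrite {2}/Num.norm/= mx_normrE.
exact: (le_bigmax _ (fun i : 'I_1 * 'I_n => `|x i.1 i.2|) (ord0, i)).
Qed.

Lemma norm_rV_le x e : 0 <= e -> (forall i, `|x ord0 i| <= e) -> `|x| <= e.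
Proof.
move=> e0 xe; rewrite {1}/Num.norm/= mx_normrE.
by apply/bigmax_leP; split => // -[j i] _ /=; rewrite ord1.
Qed.

Lemma norm_rV_lt x e : 0 < e -> (forall i, `|x ord0 i| < e) -> `|x| < e.
Proof.
move=> e0 xe; rewrite {1}/Num.norm/= mx_normrE.
by apply/bigmax_ltP; split => // -[j i] _ /=; rewrite ord1.
Qed.

Lemma measurable_ball_rV x (e : R) : measurable [set y | `|x - y| < e].
Proof.
have [e0|e0] := ltP 0 e; last first.
  rewrite (_ : [set _ | _] = set0)//; apply/seteqP; split => // y /=.
  by rewrite ltNge (le_trans e0).
rewrite (_ : [set _ | _] = rV_box (fun i => [set t | `|x ord0 i - t| < e])).
  apply: measurable_rV_box => i.
  have -> : [set t | `|x ord0 i - t| < e] = ball (x ord0 i) e by [].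
  exact: measurable_ball.
apply/seteqP; split => y /= h.
  move=> i /=; apply: le_lt_trans h.
  by rewrite (le_trans _ (coord_le_norm _ i))// !mxE.
by apply: norm_rV_lt => // i; have := h i; rewrite !mxE.
Qed.

(** An open set is the union of the balls with rational centre and radius
    [1 / (k + 1)] that it contains, a countable family. *)
Lemma open_measurable_rV (U : set 'rV[R]_n) : open U -> measurable U.
Proof.
move=> oU.
pose q (p : 'rV[rat]_n * nat) : 'rV[R]_n := map_mx ratr p.1.
pose r (p : 'rV[rat]_n * nat) : R := p.2.+1%:R^-1.
pose B p : set 'rV[R]_n := [set y | `|q p - y| < r p].
rewrite (_ : U = \bigcup_(p in setT) (if `[< B p `<=` U >] then B p else set0)).
  apply: countable_bigcupT_measurable; first exact: countableP.
  by move=> p; case: ifPn => _ //; exact: measurable_ball_rV.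
apply/seteqP; split => [x Ux|x [p _]]; last by case: asboolP => // BU Bx; exact: BU.
have [e /= e0 xe] : nbhs_ball x U by apply/nbhs_ballP; exact: open_nbhs_nbhs.
have [k ke] : exists k, k.+1%:R^-1 < e / 2.
  exists (Num.truncn (e / 2)^-1).
  by rewrite invf_plt ?posrE ?divr_gt0// truncnS_gt.
have qi i : exists s : rat, `|ratr s - x ord0 i| < k.+1%:R^-1.
  have /rat_in_itvoo[s] : x ord0 i - k.+1%:R^-1 < x ord0 i + k.+1%:R^-1.
    by rewrite ltrBlDr -addrA ltrDl addr_gt0.
  rewrite in_itv/= => /andP[s1 s2]; exists s.
  by rewrite ltr_norml ltrBrDr addrC s1/= ltrBlDr addrC.
pose s i := projT1 (cid (qi i)).
pose p : 'rV[rat]_n * nat := (\row_i s i, k).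
exists p => //.
have Bpx : B p x.
  rewrite /B/=; apply: norm_rV_lt; first by rewrite /r invr_gt0.
  by move=> i; rewrite /q/= !mxE; exact: (projT2 (cid (qi i))).
case: asboolP => // -[] y /= By; apply: xe; rewrite mx_norm_ball /ball_ /=.
rewrite (_ : x - y = (q p - y) - (q p - x)); last first.
  by rewrite opprB [RHS]addrC addrA subrK.
rewrite (le_lt_trans (ler_normB _ _))// (splitr e) ltrD//.
  exact: lt_trans By ke.
exact: lt_trans Bpx ke.
Qed.

Lemma continuous_measurable_rV (f : 'rV[R]_n -> R) :
  continuous f -> measurable_fun setT f.
Proof.
move=> /continuousP cf; apply: (measurability _ (RGenOpens.measurableE R)) => //.
move=> _ [_ [a [b ->] <-]]; rewrite setTI; apply: open_measurable_rV.
by apply: cf; exact: interval_open.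
Qed.

Lemma measurable_addrV d (T : measurableType d) (f g : T -> 'rV[R]_n) :
  measurable_fun setT f -> measurable_fun setT g ->
  measurable_fun setT (fun t => f t + g t).
Proof.
move=> mf mg; apply: measurable_fun_rV => i.
rewrite (_ : (fun _ => _) = (fun t => f t ord0 i) \+ (fun t => g t ord0 i)).
  apply: measurable_funD.
    by apply: (measurableT_comp (measurable_coord i)).
  by apply: (measurableT_comp (measurable_coord i)).
by apply/funext => t/=; rewrite mxE.
Qed.

Lemma measurable_opprV d (T : measurableType d) (f : T -> 'rV[R]_n) :
  measurable_fun setT f -> measurable_fun setT (fun t => - f t).
Proof.
move=> mf; apply: measurable_fun_rV => i.
rewrite (_ : (fun _ => _) = \- (fun t => f t ord0 i)).
  by apply: measurable_funN; apply: (measurableT_comp (measurable_coord i)).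
by apply/funext => t/=; rewrite mxE.
Qed.

End norm_rV.

(** * Tensor integrals and a slowly varying integrable weight *)

Section tensor_integral.
Context {R : realType}.
Local Notation mu := (@lebesgue_measure R).

(** The map along which [lebesgue_rV n.+1] is the push-forward of a product
    measure. *)
Definition rV_cons n (p : measurableTypeR R * 'rV[R]_n) : 'rV[R]_n.+1 :=
  \row_i (if unlift ord0 i is Some j then p.2 ord0 j else p.1).

Lemma measurable_rV_cons n : measurable_fun setT (@rV_cons n).
Proof.
apply: measurable_fun_rV => i; case: (unliftP ord0 i) => [j ->|->].
  apply: (eq_measurable_fun ((fun x : 'rV[R]_n => x ord0 j) \o snd)).
    by move=> -[t x] _; rewrite /rV_cons mxE liftK.
  by apply: measurableT_comp => //; exact: measurable_coord.
apply: (eq_measurable_fun fst) => // -[t x] _.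
by rewrite /rV_cons mxE unlift_none.
Qed.

Lemma measurable_tensor n (f : 'I_n -> R -> R) :
  (forall i, measurable_fun setT (f i)) ->
  measurable_fun setT (fun x : 'rV[R]_n => \prod_i f i (x ord0 i)).
Proof.
move=> mf; elim: index_enum => [|i s IH].
  rewrite (_ : (fun _ => _) = cst 1); first exact: measurable_cst.
  by apply/funext => x; rewrite big_nil.
rewrite (_ : (fun _ => _) =
    (fun x : 'rV[R]_n => f i (x ord0 i) * \prod_(j <- s) f j (x ord0 j))).
  apply: measurable_funM => //.
  by apply: measurableT_comp => //; exact: measurable_coord.
by apply/funext => x; rewrite big_cons.
Qed.

(** Tonelli, one coordinate at a time. *)
Lemma ge0_integral_tensor n (f : R -> R) : measurable_fun setT f ->
  (forall t, 0 <= f t) ->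
  (\int[lebesgue_rV n]_x (\prod_i f (x ord0 i))%:E =
   \prod_(i < n) \int[mu]_t (f t)%:E)%E.
Proof.
move=> mf f0; elim: n => [|n IH].
  rewrite big_ord0 integral_dirac//=; last first.
    apply/measurable_EFinP; exact: (measurable_tensor (fun=> mf)).
  by rewrite diracE mem_set// mul1e big_ord0.
rewrite big_ord_recl -IH.
have := @ge0_integral_pushforward _ _ _ _ R _ (@measurable_rV_cons n)
  (@lebesgue_measure R \x lebesgue_rV n)%E setT
  (fun x => (\prod_i f (x ord0 i))%:E) measurableT _ _.
rewrite preimage_setT => E; etransitivity; first apply: E.
- by apply/measurable_EFinP; exact: (measurable_tensor (fun=> mf)).
- by move=> x _; rewrite lee_fin prodr_ge0.
have -> : ((fun x : 'rV[R]_n.+1 => (\prod_i f (x ord0 i))%:E) \o @rV_cons n) =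
  (fun p => (f p.1)%:E * (\prod_i f (p.2 ord0 i))%:E)%E.
  apply/funext => -[t x] /=; rewrite -EFinM; congr EFin.
  rewrite big_ord_recl /rV_cons mxE unlift_none/=; congr (_ * _).
  by apply: eq_bigr => i _; rewrite mxE liftK.
rewrite fubini_tonelli1//=; last 2 first.
- apply: emeasurable_funM; apply/measurable_EFinP.
    exact: measurableT_comp.
  by apply: (measurableT_comp (measurable_tensor (fun=> mf))).
- by move=> p; rewrite -EFinM lee_fin mulr_ge0// prodr_ge0.
rewrite /fubini_F/=.
under eq_integral => t _.
  rewrite ge0_integralZl_EFin//; last first.
  - by apply/measurable_EFinP; exact: (measurable_tensor (fun=> mf)).
  - by move=> x _; rewrite lee_fin prodr_ge0.
  over.
rewrite ge0_integralZr//.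
- exact/measurable_EFinP.
- by move=> t _; rewrite lee_fin.
- by apply: integral_ge0 => x _; rewrite lee_fin prodr_ge0.
Qed.

(** A majorant of rapidly decaying functions that is integrable and yet
    varies slowly: a bounded translation costs a constant factor. This lets all
    later estimates be pointwise bounds by one fixed weight instead of bounds on
    L^1 norms. *)
Definition cauchy_weight (t : R) : R := (1 + t ^+ 2)^-1.

Lemma cauchy_weight_gt0 t : 0 < cauchy_weight t.
Proof. by rewrite invr_gt0 ltr_pwDl// sqr_ge0. Qed.

Lemma measurable_cauchy_weight : measurable_fun setT cauchy_weight.
Proof. exact: (continuous_measurable_fun (@continuous_oneDsqrV R)). Qed.

Lemma integral_cauchy_weight_lty : (\int[mu]_t (cauchy_weight t)%:E < +oo)%E.
Proof.
have mc : measurable_fun setT (EFin \o cauchy_weight).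
  apply/measurable_EFinP; exact: measurable_cauchy_weight.
have c0 t : (0 <= (cauchy_weight t)%:E)%E by rewrite lee_fin ltW ?cauchy_weight_gt0.
have I0 : (\int[mu]_(t in `[0%R, +oo[) (cauchy_weight t)%:E = (pi / 2)%:E)%E.
  exact: (@integral0y_oneDsqr R).
have I1 : (\int[mu]_(t in `]-oo, 0%R]) (cauchy_weight t)%:E = (pi / 2)%:E)%E.
  rewrite -I0 ge0_integration_by_substitution0//.
  by apply: eq_integral => t _; rewrite /cauchy_weight sqrrN.
have -> : [set: measurableTypeR R] = `]-oo, 0%R]%classic `|` `]0, +oo[%classic.
  by rewrite -itv_bndbnd_setU// set_itvE.
rewrite ge0_integral_setU//=.
- rewrite I1 lte_add_pinfty ?ltry//.
  apply: (@le_lt_trans _ _ (pi / 2)%:E); last exact: ltry.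
  rewrite -I0; apply: ge0_subset_integral => //=.
  + exact: measurable_funS mc.
  + by apply: subset_itvr; rewrite bnd_simp.
- exact: measurable_funS mc.
- apply/disj_setPLR => t /=; rewrite !in_itv/= andbT => t0.
  by apply/negP; rewrite -leNgt.
Qed.

Definition weight n (x : 'rV[R]_n) : R := \prod_i cauchy_weight (x ord0 i).

Lemma weight_gt0 n (x : 'rV[R]_n) : 0 < weight x.
Proof. by rewrite prodr_gt0// => i _; exact: cauchy_weight_gt0. Qed.

Lemma measurable_weight n : measurable_fun setT (@weight n).
Proof. exact: (measurable_tensor (fun=> measurable_cauchy_weight)). Qed.

Lemma integrable_weight n : (lebesgue_rV n).-integrable setT (EFin \o @weight n).
Proof.
apply/integrableP; split; first by apply/measurable_EFinP; exact: measurable_weight.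
under eq_integral do rewrite /= gtr0_norm ?weight_gt0//.
rewrite ge0_integral_tensor//.
- rewrite ltey_eq; apply/orP; left.
  elim/big_ind : _ => // [x y fx fy|i _]; first exact: fin_numM.
  rewrite ge0_fin_numE ?integral_cauchy_weight_lty// integral_ge0// => t _.
  by rewrite lee_fin ltW ?cauchy_weight_gt0.
- exact: measurable_cauchy_weight.
- by move=> t; rewrite ltW ?cauchy_weight_gt0.
Qed.

Lemma cauchy_weight_shift c t s : 0 <= c -> `|s| <= c ->
  cauchy_weight (t - s) <= (1 + c) ^+ 2 * 2 * cauchy_weight t.
Proof.
move=> c0; rewrite ler_norml => /andP[s1 s2].
have p0 r : 0 < 1 + r ^+ 2 :> R by rewrite ltr_pwDl// sqr_ge0.
rewrite /cauchy_weight ler_pdivlMr// mulrC ler_pdivrMr//.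
have h1 : 0 <= (c - s) * (c + s).
  by apply: mulr_ge0; [rewrite subr_ge0|rewrite -lerBlDl sub0r].
have := sqr_ge0 (t - s - s); have := sqr_ge0 (t - s).
have := mulr_ge0 c0 (sqr_ge0 (t - s)); have := mulr_ge0 (mulr_ge0 c0 c0) (sqr_ge0 (t - s)).
nra.
Qed.

Lemma weight_shift n c (x y : 'rV[R]_n) : 0 <= c -> `|y| <= c ->
  weight (x - y) <= ((1 + c) ^+ 2 * 2) ^+ n * weight x.
Proof.
move=> c0 yc; rewrite /weight -[X in _ ^+ X]card_ord -prodr_const -big_split/=.
apply: ler_prod => i _; rewrite (ltW (cauchy_weight_gt0 _))/= !mxE.
by apply: cauchy_weight_shift => //; apply: le_trans yc; exact: coord_le_norm.
Qed.

End tensor_integral.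

(** * Change of variables for real integrals *)

Section integral_rV.
Context {R : realType} (n : nat).
Local Notation L := (lebesgue_rV n : {measure set 'rV[R]_n -> \bar R}).
Implicit Types (x y b : 'rV[R]_n) (f : 'rV[R]_n -> R).

Lemma integrable_rV_affine (a : R) b f : 0 < a ->
  L.-integrable setT (EFin \o f) ->
  L.-integrable setT (EFin \o (fun x => f (a *: x + b))).
Proof.
move=> a0 /integrableP[/measurable_EFinP mf foo]; apply/integrableP; split.
  by apply/measurable_EFinP; apply: (measurableT_comp mf (measurable_affine a b)).
have := @ge0_integral_rV_affine R n a b (fun x => `|(f x)%:E|%E) a0.
move=> /= -> //.
  rewrite lte_mul_pinfty// lee_fin.
  by rewrite invr_ge0 exprn_ge0// ltW.
by apply/measurable_EFinP; exact: measurableT_comp.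
Qed.

Lemma Rintegral_rV_affine (a : R) b f : 0 < a ->
  L.-integrable setT (EFin \o f) ->
  \int[L]_x f (a *: x + b) = a ^- n * \int[L]_x f x.
Proof.
move=> a0 If; have /integrableP[mf _] := If.
rewrite /Rintegral [in LHS]integralE [in RHS]integralE.
transitivity (fine ((a ^- n)%:E * \int[L]_x (EFin \o f)^\+ x -
                    (a ^- n)%:E * \int[L]_x (EFin \o f)^\- x)%E).
  congr (fine (_ - _)).
  - rewrite -(@ge0_integral_rV_affine R n a b ((EFin \o f)^\+)%E)//.
      by apply: eq_integral => x _; rewrite !funeposE.
    exact: measurable_funepos.
  - rewrite -(@ge0_integral_rV_affine R n a b ((EFin \o f)^\-)%E)//.
      by apply: eq_integral => x _; rewrite !funenegE.
    exact: measurable_funeneg.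
have := integrable_pos_fin_num measurableT If.
have := integrable_neg_fin_num measurableT If.
move=> /fineK <- /fineK <-.
by rewrite -!EFinM -!EFinB/= mulrBr.
Qed.

Lemma ge0_integral_rV_translate b (f : 'rV[R]_n -> \bar R) :
  measurable_fun setT f -> (forall x, 0 <= f x)%E ->
  (\int[L]_x f (x + b)%R = \int[L]_x f x)%E.
Proof.
move=> mf f0; have := ge0_integral_rV_affine b ltr01 mf f0.
rewrite expr1n invr1 mul1e => <-.
by apply: eq_integral => x _; rewrite scale1r.
Qed.

Lemma integrable_rV_translate b f :
  L.-integrable setT (EFin \o f) ->
  L.-integrable setT (EFin \o (fun x => f (x + b))).
Proof.
move=> If; have := integrable_rV_affine b ltr01 If.
by rewrite (_ : (fun x => f (1 *: x + b)) = (fun x => f (x + b))) //;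
  apply/funext => x; rewrite scale1r.
Qed.

Lemma Rintegral_rV_translate b f : L.-integrable setT (EFin \o f) ->
  \int[L]_x f (x + b) = \int[L]_x f x.
Proof.
move=> If; have := Rintegral_rV_affine b ltr01 If.
rewrite expr1n invr1 mul1r => <-.
by apply: eq_Rintegral => x _; rewrite scale1r.
Qed.

End integral_rV.

(** * Unfolding integrals over the torus *)

Section restricted_measure.
Context d (T : measurableType d) (R : realType).
Variables (mu : {measure set T -> \bar R}) (D : set T) (mD : measurable D).

Lemma ge0_integral_mrestr (f : T -> \bar R) :
  measurable_fun setT f -> (forall x, 0 <= f x)%E ->
  (\int[mrestr mu mD]_x f x = \int[mu]_(x in D) f x)%E.
Proof.
move=> mf f0.
have -> : [set: T] = D `|` ~` D by rewrite setUv.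
rewrite ge0_integral_setU//=; last 3 first.
- exact: measurableC.
- exact: measurable_funTS.
- by apply/disj_set2P; rewrite setICr.
rewrite [X in (_ + X)%E]null_set_integral ?adde0//.
- by apply: eq_measure_integral => A mA AD; rewrite /= /mrestr setIidl.
- exact: measurableC.
- exact: measurable_funTS.
- by rewrite /= /mrestr setICl measure0.
Qed.

End restricted_measure.

(** Turns a sum over a countable index type into a series, to which
    term-by-term integration applies. *)
Lemma esum_pickle (R : realType) (I : countType) (a : I -> \bar R) :
  (forall i, 0 <= a i)%E ->
  (\esum_(i in [set: I]) a i = \sum_(k <oo) oapp a 0 (@pickle_inv I k))%E.
Proof.
move=> a0; rewrite nneseries_esumT; last first.
  by move=> k; case: pickle_inv => [i|] //=.
rewrite [RHS](_ : _ = \esum_(k in range (@choice.pickle I)) oapp a 0%E (@pickle_inv I k))%E.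
  rewrite (reindex_esum [set: I] _ (@choice.pickle I))//.
  - by apply: eq_esum => i _; rewrite pickleK_inv.
  - by split; [move=> i _; exists i|
      move=> i j _ _; exact: (pcan_inj choice.pickleK)|move=> k [i _ <-]; exists i].
rewrite [RHS]esum_mkcond; apply: eq_esum => k _.
case: ifPn => // /negP kI; case E: (@pickle_inv I k) => [i|] //=.
exfalso; apply: kI; rewrite inE; exists i => //.
by have := @pickle_invK I k; rewrite E.
Qed.

Section unfold.
Context {R : realType} (d : nat).
Local Notation L := (lebesgue_rV d : {measure set 'rV[R]_d -> \bar R}).
Local Notation T := (torus_measure d : {measure set 'rV[R]_d -> \bar R}).
Implicit Types (x : 'rV[R]_d) (l : 'rV[int]_d).
Local Notation "l %:V" := (map_mx intr l : 'rV[R]_d) (at level 2).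

Lemma intV_add l l' : (l + l')%:V = l%:V + l'%:V.
Proof. by apply/rowP => i; rewrite !mxE intrD. Qed.

Lemma intV_opp l : (- l)%:V = - l%:V.
Proof. by apply/rowP => i; rewrite !mxE intrN. Qed.

Definition floorV x : 'rV[int]_d := \row_i Num.floor (x ord0 i).

Lemma unit_cube_floorV x l : unit_cube d (x - l%:V) <-> floorV x = l.
Proof.
split=> [xl|<- i].
  apply/rowP => i; rewrite mxE; apply/floor_def.
  by have := xl i; rewrite !mxE subr_ge0 ltrBlDl intrD.
rewrite !mxE subr_ge0 floor_le/= ltrBlDl.
by have := floorD1_gt (x ord0 i); rewrite intrD.
Qed.

(** The cubes [l + [0, 1)^d] numbered by natural numbers; numbers that code no
    [l] get the empty set. *)
Definition cell (k : nat) : set 'rV[R]_d :=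
  if @pickle_inv 'rV[int]_d k is Some l then [set x | unit_cube d (x - l%:V)]
  else set0.

Lemma measurable_shifted_cube l :
  measurable [set x : 'rV[R]_d | unit_cube d (x - l%:V)].
Proof.
have := @measurable_affine R d 1 (- l%:V) measurableT _ (@measurable_unit_cube R d).
rewrite setTI (_ : _ @^-1` _ = [set x | unit_cube d (x - l%:V)])//.
by apply/seteqP; split => x /=; rewrite scale1r.
Qed.

Lemma measurable_cell k : measurable (cell k).
Proof. by rewrite /cell; case: pickle_inv => // l; exact: measurable_shifted_cube. Qed.

Lemma trivIset_cell : trivIset setT cell.
Proof.
apply/trivIsetP => i j _ _ ij; rewrite -subset0 => x []; rewrite /cell.
case Ei : pickle_inv => [l|//]; case Ej : pickle_inv => [l'|//] /=.
move=> /unit_cube_floorV xl /unit_cube_floorV xl'.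
have := @pickle_invK 'rV[int]_d i; rewrite Ei/= => ii.
have := @pickle_invK 'rV[int]_d j; rewrite Ej/= => jj.
by move: ij; rewrite -ii -jj -xl -xl' eqxx.
Qed.

Lemma bigcup_cell : \bigcup_k cell k = setT.
Proof.
apply/seteqP; split => // x _; exists (choice.pickle (floorV x)) => //.
by rewrite /cell pickleK_inv; apply/unit_cube_floorV.
Qed.

Lemma integral_shifted_cube l (h : 'rV[R]_d -> \bar R) :
  measurable_fun setT h -> (forall x, 0 <= h x)%E ->
  (\int[L]_(x in [set x | unit_cube d (x - l%:V)%R]) h x =
   \int[T]_x h (x + l%:V)%R)%E.
Proof.
move=> mh h0; rewrite ge0_integral_mrestr//; last first.
  apply: (measurableT_comp mh).
  rewrite (_ : (fun _ => _) = fun x => 1 *: x + l%:V).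
    exact: measurable_affine.
  by apply/funext => x; rewrite scale1r.
rewrite [LHS]integral_mkcond [RHS]integral_mkcond.
rewrite -[LHS](ge0_integral_rV_translate l%:V).
- apply: eq_integral => x _; rewrite !patchE.
  by congr (if _ then _ else _); apply/idP/idP; rewrite !inE/= addrK.
- apply/(measurable_restrictT _ (measurable_shifted_cube l)).
  exact: measurable_funTS.
- by move=> x; rewrite patchE; case: ifP.
Qed.

(** The sum of the integer translates, with values in the extended reals:
    [periodize] is a difference of two real parts of such sums. *)
Definition unfold (h : 'rV[R]_d -> \bar R) x : \bar R :=
  (\esum_(l in [set: 'rV[int]_d]) h (x + l%:V)%R)%E.

Lemma unfoldE h x : (forall x, 0 <= h x)%E ->
  unfold h x = (\sum_(k <oo) oapp (fun l => h (x + l%:V)%R) 0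
                              (@pickle_inv 'rV[int]_d k))%E.
Proof. by move=> h0; rewrite /unfold esum_pickle. Qed.

Lemma measurable_translate (b : 'rV[R]_d) : measurable_fun setT (fun x => x + b).
Proof.
rewrite (_ : (fun _ => _) = fun x => 1 *: x + b).
  exact: measurable_affine.
by apply/funext => x; rewrite scale1r.
Qed.

Lemma measurable_unfold h : measurable_fun setT h -> (forall x, 0 <= h x)%E ->
  measurable_fun setT (unfold h).
Proof.
move=> mh h0.
rewrite (_ : unfold h = fun x => \sum_(k <oo) oapp (fun l => h (x + l%:V)%R) 0%E
    (@pickle_inv 'rV[int]_d k))%E; last by apply/funext => x; rewrite unfoldE.
apply: ge0_emeasurable_sum => [k x _ _|k _].
  by case: pickle_inv => //=.
case: pickle_inv => [l|] /=; last exact: measurable_cst.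
by apply: (measurableT_comp mh); exact: measurable_translate.
Qed.

Lemma unfold_ge0 h x : (forall x, 0 <= h x)%E -> (0 <= unfold h x)%E.
Proof. by move=> h0; apply: esum_ge0. Qed.

(** The cubes [l + [0, 1)^d] partition R^d, and the integral over each of them
    is the integral over [0, 1)^d of a translate. *)
Lemma integral_unfold h : measurable_fun setT h -> (forall x, 0 <= h x)%E ->
  (\int[T]_x unfold h x = \int[L]_x h x)%E.
Proof.
move=> mh h0; under eq_integral do rewrite unfoldE//.
rewrite integral_nneseries//; last 2 first.
- move=> k; case: pickle_inv => [l|] /=; last exact: measurable_cst.
  by apply: (measurableT_comp mh); exact: measurable_translate.
- by move=> k x _; case: pickle_inv => //=.
rewrite -[in RHS]bigcup_cell ge0_integral_bigcup//=.
- apply: eq_eseriesr => k _; rewrite /cell; case: pickle_inv => [l|] /=.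
    by rewrite integral_shifted_cube.
  by rewrite integral_set0 integral0.
- by move=> k; exact: measurable_cell.
- exact: measurable_funTS.
- exact: trivIset_cell.
Qed.

End unfold.

(** * Inner products and norms of periodizations *)

Section unfold_inner.
Context {R : realType} (d : nat).
Local Notation L := (lebesgue_rV d : {measure set 'rV[R]_d -> \bar R}).
Local Notation T := (torus_measure d : {measure set 'rV[R]_d -> \bar R}).
Implicit Types (x : 'rV[R]_d) (l : 'rV[int]_d) (f g h : 'rV[R]_d -> R).
Local Notation "l %:V" := (map_mx intr l : 'rV[R]_d) (at level 2).

Lemma unfoldM h g x : periodic g -> (forall x, 0 <= h x) -> (forall x, 0 <= g x) ->
  unfold (fun x => (h x * g x)%:E) x = (unfold (EFin \o h) x * (g x)%:E)%E.
Proof.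
move=> pg h0 g0.
rewrite !unfoldE/=; [|by move=> y; rewrite lee_fin ?mulr_ge0..].
rewrite muleC -nneseriesZl//; last by move=> k _; case: pickle_inv => //= l; rewrite lee_fin.
apply: eq_eseriesr => k _; case: pickle_inv => [l|] /=; last by rewrite mule0.
by rewrite pg mulrC EFinM.
Qed.

Lemma measurable_fine_unfold h : measurable_fun setT h -> (forall x, 0 <= h x) ->
  measurable_fun setT (fun x => fine (unfold (EFin \o h) x)).
Proof.
move=> mh h0; apply: measurableT_comp; first exact: fine_measurable.
apply: measurable_unfold; first exact/measurable_EFinP.
by move=> x; rewrite lee_fin.
Qed.

(** The sum of the translates of an integrable function is finite almost
    everywhere on the torus, so its real part may be used under the integral; a
    periodic factor passes inside the sum. *)
Lemma ge0_integral_fine_unfold h g : L.-integrable setT (EFin \o h) ->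
  measurable_fun setT g -> periodic g ->
  (forall x, 0 <= h x) -> (forall x, 0 <= g x) ->
  (\int[T]_x (fine (unfold (EFin \o h) x) * g x)%:E = \int[L]_x (h x * g x)%:E)%E.
Proof.
move=> Ih mg pg h0 g0; have /integrableP[/measurable_EFinP mh _] := Ih.
have h0' x : (0 <= (EFin \o h) x)%E by rewrite lee_fin.
have mEh : measurable_fun setT (EFin \o h) by exact/measurable_EFinP.
rewrite -integral_unfold; last 2 first.
- by apply/measurable_EFinP; exact: measurable_funM.
- by move=> x; rewrite lee_fin mulr_ge0.
apply: ge0_ae_eq_integral => //.
- by apply/measurable_EFinP; apply: measurable_funM => //; exact: measurable_fine_unfold.
- apply: measurable_unfold; first by apply/measurable_EFinP; exact: measurable_funM.
  by move=> x; rewrite lee_fin mulr_ge0.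
- move=> x _; rewrite lee_fin mulr_ge0// fine_ge0//; exact: unfold_ge0.
- by move=> x _; apply: unfold_ge0 => y; rewrite lee_fin mulr_ge0.
have IU : T.-integrable setT (unfold (EFin \o h)).
  apply/integrableP; split; first exact: measurable_unfold.
  under eq_integral do rewrite gee0_abs ?unfold_ge0//.
  rewrite integral_unfold//; have /integrableP[_] := Ih.
  by under eq_integral do rewrite gee0_abs//.
have /= := @integrable_ae _ _ _ T setT measurableT _ IU.
apply: filterS => x /(_ I) Ux _.
by rewrite unfoldM// EFinM fineK.
Qed.

Lemma integrable_fine_unfold h g M : L.-integrable setT (EFin \o h) ->
  measurable_fun setT g -> periodic g ->
  (forall x, 0 <= h x) -> (forall x, `|g x| <= M) ->
  T.-integrable setT (EFin \o (fun x => fine (unfold (EFin \o h) x) * g x)).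
Proof.
move=> Ih mg pg h0 gM; have /integrableP[/measurable_EFinP mh hoo] := Ih.
apply/integrableP; split.
  by apply/measurable_EFinP; apply: measurable_funM => //; exact: measurable_fine_unfold.
have M0 : 0 <= M by apply: le_trans (gM 0).
apply: (@le_lt_trans _ _ (\int[T]_x (fine (unfold (EFin \o h) x) * M)%:E)%E).
  apply: ge0_le_integral => //.
  - apply/measurable_EFinP; apply: measurableT_comp => //.
    by apply: measurable_funM => //; exact: measurable_fine_unfold.
  - apply/measurable_EFinP; apply: measurable_funM => //; exact: measurable_fine_unfold.
  - move=> x _; rewrite lee_fin normrM ger0_norm; last first.
      by apply: fine_ge0; apply: unfold_ge0 => y; rewrite lee_fin.
    apply: ler_wpM2l => //; apply: fine_ge0.
    by apply: unfold_ge0 => y; rewrite lee_fin.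
rewrite (@ge0_integral_fine_unfold h (cst M))//=.
under eq_integral do rewrite mulrC EFinM.
rewrite ge0_integralZl_EFin//; last 2 first.
- by move=> x _; rewrite lee_fin.
- exact/measurable_EFinP.
rewrite lte_mul_pinfty// (le_lt_trans _ hoo)// ge0_le_integral//.
- by move=> x _; rewrite lee_fin.
- exact/measurable_EFinP.
- by apply: measurableT_comp => //; exact/measurable_EFinP.
- by move=> x _; rewrite /= lee_fin ler_norm.
Qed.

Lemma integrableM_bounded h g M : L.-integrable setT (EFin \o h) ->
  measurable_fun setT g -> (forall x, `|g x| <= M) ->
  L.-integrable setT (EFin \o (fun x => h x * g x)).
Proof.
move=> Ih mg gM; have /integrableP[/measurable_EFinP mh hoo] := Ih.
have M0 : 0 <= M by apply: le_trans (gM 0).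
apply: (@le_integrable _ _ _ _ _ _ _ (EFin \o (fun x => M * h x))) => //.
- by apply/measurable_EFinP; exact: measurable_funM.
- by move=> x _; rewrite /= lee_fin !normrM mulrC ler_wpM2r// (le_trans (gM x))// ler_norm.
- exact: (integrableZl measurableT M Ih).
Qed.

Lemma Rintegral_fine_unfold h g M : L.-integrable setT (EFin \o h) ->
  measurable_fun setT g -> periodic g ->
  (forall x, 0 <= h x) -> (forall x, `|g x| <= M) ->
  \int[T]_x (fine (unfold (EFin \o h) x) * g x) = \int[L]_x (h x * g x).
Proof.
move=> Ih mg pg h0 gM.
have pos k : measurable_fun setT k -> periodic k -> (forall x, 0 <= k x) ->
    \int[T]_x (fine (unfold (EFin \o h) x) * k x) = \int[L]_x (h x * k x).
  by move=> mk pk k0; rewrite /Rintegral ge0_integral_fine_unfold.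
have mgM : measurable_fun setT (fun x => g x + M) by exact: measurable_funD.
have M0 : 0 <= M by apply: le_trans (gM 0).
have gM' x : `|g x + M| <= M + M by rewrite (le_trans (ler_normD _ _))// lerD// ger0_norm.
have gMge0 x : 0 <= g x + M by have := gM x; rewrite ler_norml -lerBlDr sub0r => /andP[].
(* Writing [g] as [(g + M) - M] reduces a signed bounded factor to
two nonnegative ones. *)
have E y z : y * z = y * (z + M) - y * M :> R by rewrite -mulrBr addrK.
under eq_Rintegral do rewrite E.
under [RHS]eq_Rintegral do rewrite E.
rewrite RintegralB//; last 2 first.
- apply: (@integrable_fine_unfold h (fun x => g x + M) (M + M)) => //.
  by move=> l x; rewrite pg.
- by apply: (@integrable_fine_unfold h (cst M) M) => //= x; rewrite ger0_norm.
rewrite [RHS]RintegralB//; last 2 first.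
- exact: (@integrableM_bounded h (fun x => g x + M) (M + M)).
- by apply: (@integrableM_bounded h (cst M) M) => //= x; rewrite ger0_norm.
rewrite (pos (fun x => g x + M))//; last by move=> l x; rewrite pg.
by rewrite (pos (cst M)).
Qed.

Lemma periodizeE f x : periodize f x =
  fine (unfold (EFin \o (f^\+)) x) - fine (unfold (EFin \o (f^\-)) x).
Proof.
rewrite /periodize /unfold; congr (fine _ - fine _); apply: eq_esum => l _.
  by rewrite funeposE /= /funrpos EFin_max.
by rewrite funenegE /= /funrneg EFin_max.
Qed.

Lemma torus_inner_periodize f g M : L.-integrable setT (EFin \o f) ->
  measurable_fun setT g -> periodic g -> (forall x, `|g x| <= M) ->
  torus_inner (periodize f) g = \int[L]_x (f x * g x).
Proof.
move=> If mg pg gM.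
have Ip : L.-integrable setT (EFin \o f^\+) by exact: integrable_funrpos.
have In : L.-integrable setT (EFin \o f^\-) by exact: integrable_funrneg.
have p0 x : 0 <= f^\+ x by rewrite /funrpos le_max lexx orbT.
have n0 x : 0 <= f^\- x by rewrite /funrneg le_max lexx orbT.
rewrite /torus_inner.
under eq_Rintegral do rewrite periodizeE mulrBl.
rewrite RintegralB//; last 2 first.
- exact: (integrable_fine_unfold Ip mg pg p0 gM).
- exact: (integrable_fine_unfold In mg pg n0 gM).
rewrite (Rintegral_fine_unfold Ip mg pg p0 gM).
rewrite (Rintegral_fine_unfold In mg pg n0 gM).
rewrite -RintegralB//; last 2 first.
- exact: (integrableM_bounded Ip mg gM).
- exact: (integrableM_bounded In mg gM).
apply: eq_Rintegral => x _; rewrite -mulrBl.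
by rewrite -[in RHS](funrposBneg f).
Qed.

Lemma measurable_periodize f : measurable_fun setT f ->
  measurable_fun setT (periodize f).
Proof.
move=> mf; rewrite (_ : periodize f = (fun x => fine (unfold (EFin \o f^\+) x)) \-
  (fun x => fine (unfold (EFin \o f^\-) x))).
  apply: measurable_funB; apply: measurable_fine_unfold.
  - exact: measurable_funrpos.
  - by move=> x; rewrite /funrpos le_max lexx orbT.
  - exact: measurable_funrneg.
  - by move=> x; rewrite /funrneg le_max lexx orbT.
by apply/funext => x; rewrite periodizeE.
Qed.

Lemma unfold_periodic (h : 'rV[R]_d -> \bar R) l x : (forall x, 0 <= h x)%E ->
  unfold h (x + l%:V) = unfold h x.
Proof.
move=> h0; rewrite /unfold.
rewrite [RHS](reindex_esum [set: 'rV[int]_d] _ (fun k => l + k))//.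
  by apply: eq_esum => k _; rewrite intV_add addrA.
Qed.

Lemma periodic_periodize f : periodic (periodize f).
Proof.
move=> l x; rewrite !periodizeE !unfold_periodic// => y; rewrite lee_fin.
  by rewrite /funrneg le_max lexx orbT.
by rewrite /funrpos le_max lexx orbT.
Qed.

Lemma unfold_single (h : 'rV[R]_d -> \bar R) x l : (forall x, 0 <= h x)%E ->
  (forall k, k != l -> h (x + k%:V) = 0%E) -> unfold h x = h (x + l%:V).
Proof.
move=> h0 hl; rewrite /unfold -(@esum_set1 _ _ l (fun k => h (x + k%:V)))//.
rewrite [RHS]esum_mkcond; apply: eq_esum => k _.
have [->|kl] := eqVneq k l; first by rewrite mem_set.
by rewrite memNset ?hl// => /eqP; rewrite (negbTE kl).
Qed.

(** At most one translate is nonzero at each point, so the square of the sum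
    is the sum of the squares. *)
Lemma sqr_periodize f x :
  (forall k l, f (x + k%:V) != 0 -> f (x + l%:V) != 0 -> k = l) ->
  ((periodize f x) ^+ 2)%:E = unfold (fun y => (f y ^+ 2)%:E) x.
Proof.
move=> fd.
have p0 y : (0 <= (f^\+ y)%:E)%E by rewrite lee_fin /funrpos le_max lexx orbT.
have n0 y : (0 <= (f^\- y)%:E)%E by rewrite lee_fin /funrneg le_max lexx orbT.
have [l fl] : exists l, forall k, k != l -> f (x + k%:V) = 0.
  have [[l fl]|] := pselect (exists l, f (x + l%:V) != 0).
    by exists l => k kl; apply/eqP; apply: contraTT kl => /fd /(_ fl) ->; rewrite eqxx.
  by move/forallNP => f0; exists 0 => k _; apply/eqP/negPn/negP; exact: f0.
rewrite periodizeE !(@unfold_single _ x l)//=; last 3 first.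
- by move=> k /fl ->; rewrite expr0n.
- by move=> k /fl fk; rewrite /funrneg fk oppr0 maxxx.
- by move=> k /fl fk; rewrite /funrpos fk maxxx.
- by rewrite -[in RHS](funrposBneg f).
- by move=> y; rewrite lee_fin sqr_ge0.
Qed.

Lemma Lnorm2E dd (X : measurableType dd) (mu : {measure set X -> \bar R}) (f : X -> R) :
  ('N[mu]_2%:E[EFin \o f] = (\int[mu]_x ((f x) ^+ 2)%:E) `^ 2^-1)%E.
Proof.
rewrite unlock; congr (_ `^ _)%E; apply: eq_integral => x _.
by rewrite /= powR_mulrn// -normrX ger0_norm ?sqr_ge0.
Qed.

Lemma torus_norm2_periodize f : measurable_fun setT f ->
  (forall x k l, f (x + k%:V) != 0 -> f (x + l%:V) != 0 -> k = l) ->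
  torus_norm 2%:E (periodize f) = ('N[L]_2%:E[EFin \o f])%E.
Proof.
move=> mf fd; rewrite /torus_norm !Lnorm2E; congr (_ `^ _)%E.
under eq_integral => x _. rewrite sqr_periodize; last by move=> k l; exact: fd. over.
rewrite integral_unfold//.
- by apply/measurable_EFinP; exact: measurable_funX.
- by move=> x; rewrite lee_fin sqr_ge0.
Qed.

End unfold_inner.

(** * Convolution and duality *)

Section Rintegral_fubini.
Context d1 d2 (T1 : measurableType d1) (T2 : measurableType d2) (R : realType).
Variable m1 : {sigma_finite_measure set T1 -> \bar R}.
Variable m2 : {sigma_finite_measure set T2 -> \bar R}.

Lemma measurable_Rintegral_fubini (f : T1 * T2 -> R) : measurable_fun setT f ->
  measurable_fun setT (fun x => \int[m2]_y f (x, y)).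
Proof.
move=> mf.
have mE : measurable_fun setT (EFin \o f) by exact/measurable_EFinP.
apply: measurableT_comp; first exact: fine_measurable.
rewrite (_ : (fun _ => _) = fun x => (fubini_F m2 (EFin \o f)^\+ x -
  fubini_F m2 (EFin \o f)^\- x)%E); last first.
  apply/funext => x; rewrite integralE /fubini_F.
  by congr (_ - _)%E; apply: eq_integral => y _; rewrite ?funeposE ?funenegE.
apply: emeasurable_funB; apply: measurable_fun_fubini_tonelli_F => //.
  exact: measurable_funepos.
exact: measurable_funeneg.
Qed.

(** The bounds hold for every [x] and every [y], not just almost everywhere,
    so all the inner real integrals are genuine. *)
Lemma Rintegral_fubini (f : T1 * T2 -> R) (c : R) (a : T2 -> R) :
  measurable_fun setT f -> m2.-integrable setT (EFin \o a) ->
  (forall x y, `|f (x, y)| <= c * `|a y|) ->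
  (forall y, (\int[m1]_x `|f (x, y)|%:E <= (c * `|a y|)%:E)%E) ->
  \int[m1]_x \int[m2]_y f (x, y) = \int[m2]_y \int[m1]_x f (x, y).
Proof.
move=> mf ia fa fc.
have mE : measurable_fun setT (EFin \o f) by exact/measurable_EFinP.
have ica : m2.-integrable setT (EFin \o (fun y => c * `|a y|)).
  have := integrableZl measurableT c (integrable_norm ia).
  exact.
have i2 x : m2.-integrable setT (EFin \o (fun y => f (x, y))).
  apply: (le_integrable measurableT _ _ ica) => //=.
    by apply/measurable_EFinP; exact: measurableT_comp.
  by move=> y _; rewrite lee_fin (le_trans (fa x y))// ler_norm.
have i1 y : m1.-integrable setT (EFin \o (fun x => f (x, y))).
  apply/integrableP; split.
    by apply/measurable_EFinP; exact: measurableT_comp.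
  by apply: le_lt_trans (fc y) _; exact: ltry.
have I : (m1 \x m2)%E.-integrable setT (EFin \o f).
  apply/(integrable21ltyP _ _ mE).
  have /integrableP[mca] := ica; apply: le_lt_trans.
  apply: ge0_le_integral => //.
  - by move=> y _; exact: integral_ge0.
  - apply: (@measurable_fun_fubini_tonelli_G _ _ _ _ _ m1 (abse \o (EFin \o f))) => //=.
    by apply/measurable_EFinP; exact: measurableT_comp.
  - by apply: measurableT_comp.
  - move=> y _; apply: (le_trans (fc y)).
    by rewrite /= lee_fin ler_norm.
have := Fubini I => /= E.
rewrite /Rintegral; congr fine.
transitivity (\int[m1]_x \int[m2]_y (f (x, y))%:E)%E.
  apply: eq_integral => x _; rewrite fineK//.
  exact: (integrable_fin_num measurableT (i2 x)).
rewrite E; apply: eq_integral => y _; rewrite fineK//.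
exact: (integrable_fin_num measurableT (i1 y)).
Qed.

End Rintegral_fubini.

Section convolution.
Context {R : realType} (d : nat).
Local Notation L := (lebesgue_rV d : {measure set 'rV[R]_d -> \bar R}).
Implicit Types (x y z : 'rV[R]_d) (f g k F G : 'rV[R]_d -> R).

Definition convolve k F x := \int[L]_y (k y * F (x - y)).

Definition bounded_measurable F :=
  measurable_fun setT F /\ exists M, forall x, `|F x| <= M.

Lemma measurable_convolve k F : measurable_fun setT k -> measurable_fun setT F ->
  measurable_fun setT (convolve k F).
Proof.
move=> mk mF.
apply: (@measurable_Rintegral_fubini _ _ _ _ _ (lebesgue_rV d)
  (fun p : 'rV[R]_d * 'rV[R]_d => k p.2 * F (p.1 - p.2))).
apply: measurable_funM; first exact: measurableT_comp.
apply: (measurableT_comp mF); apply: measurable_addrV => //.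
by apply: measurable_opprV.
Qed.

Lemma measurable_reflect x : measurable_fun setT (fun y => x - y).
Proof. by apply: measurable_addrV => //; exact: measurable_opprV. Qed.

Lemma integrable_convolve k F x : L.-integrable setT (EFin \o k) ->
  bounded_measurable F ->
  L.-integrable setT (EFin \o (fun y => k y * F (x - y))).
Proof.
move=> ik [mF [M FM]].
apply: (@integrableM_bounded _ _ k (fun y => F (x - y)) M) => //.
by apply: (measurableT_comp mF); exact: measurable_reflect.
Qed.


Lemma Rintegral_kernel_le k (h : 'rV[R]_d -> R) M :
  L.-integrable setT (EFin \o k) ->
  L.-integrable setT (EFin \o (fun y => k y * h y)) ->
  (forall y, k y != 0 -> `|h y| <= M) ->
  `|\int[L]_y (k y * h y)| <= (\int[L]_y `|k y|) * M.
Proof.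
move=> ik i1 hM.
apply: le_trans (le_normr_Rintegral measurableT i1) _.
have in_ := integrable_norm ik.
rewrite -(RintegralZr M measurableT in_); apply: le_Rintegral => //.
- exact: integrable_norm i1.
- exact: (integrableZr measurableT M in_).
move=> y _ /=; have [->|ky] := eqVneq (k y) 0; first by rewrite /= mul0r !normr0 mul0r.
by rewrite normrM ler_wpM2l// hM.
Qed.

Lemma convolve_le k F x M : L.-integrable setT (EFin \o k) -> bounded_measurable F ->
  (forall y, k y != 0 -> `|F (x - y)| <= M) ->
  `|convolve k F x| <= (\int[L]_y `|k y|) * M.
Proof.
by move=> ik bF FM; apply: Rintegral_kernel_le => //; exact: integrable_convolve.
Qed.

Lemma bounded_measurableB F G : bounded_measurable F -> bounded_measurable G ->
  bounded_measurable (fun x => F x - G x).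
Proof.
move=> [mF [M FM]] [mG [N GN]]; split; first exact: measurable_funB.
by exists (M + N) => x; rewrite (le_trans (ler_normB _ _))// lerD.
Qed.

Lemma bounded_measurable_translate F y : bounded_measurable F ->
  bounded_measurable (fun x => F (x - y)).
Proof.
move=> [mF [M FM]]; split; last by exists M.
by apply: (measurableT_comp mF); exact: measurable_translate.
Qed.

Lemma bounded_measurable_convolve k F : L.-integrable setT (EFin \o k) ->
  bounded_measurable F -> bounded_measurable (convolve k F).
Proof.
move=> ik bF; have [mF [M FM]] := bF; split.
  by apply: measurable_convolve => //; have /integrableP[/measurable_EFinP] := ik.
by exists (\int[L]_y `|k y| * M) => x; apply: convolve_le.
Qed.

(** The transpose of convolution by [k] is correlation with [k]. Both sides
    equal the integral over [y] of [k y] times the integral of [F z * g (z + y)],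
    by Fubini on each side and the translation [x = z + y]. *)
Lemma inner_convolve k F g N : L.-integrable setT (EFin \o k) ->
  L.-integrable setT (EFin \o F) -> bounded_measurable F ->
  measurable_fun setT g -> (forall x, `|g x| <= N) ->
  \int[L]_x (convolve k F x * g x) = \int[L]_z (F z * \int[L]_y (k y * g (z + y))).
Proof.
move=> ik iF bF mg gN; have [mF [M FM]] := bF.
have /integrableP[/measurable_EFinP mk _] := ik.
have N0 : 0 <= N by apply: le_trans (gN 0).
have M0 : 0 <= M by apply: le_trans (FM 0).
have ig z : L.-integrable setT (EFin \o (fun y => k y * g (z + y))).
  apply: (@integrableM_bounded _ _ k (fun y => g (z + y)) N) => //.
  by apply: (measurableT_comp mg); apply: measurable_addrV.
pose c := N * \int[L]_x `|F x|.
have IF0 : 0 <= \int[L]_x `|F x| by exact: Rintegral_ge0.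
have c0 : 0 <= c by rewrite mulr_ge0.
have FE (f : 'rV[R]_d -> R) : L.-integrable setT (EFin \o f) ->
    (\int[L]_x `|f x|%:E = (\int[L]_x `|f x|)%:E)%E.
  move=> iff; rewrite fineK//; apply: integrable_fin_num => //.
  exact: (integrable_norm iff).
transitivity (\int[L]_x \int[L]_y (k y * F (x - y) * g x)).
  apply: eq_Rintegral => x _; rewrite -RintegralZr//.
  exact: integrable_convolve.
rewrite (@Rintegral_fubini _ _ _ _ _ (lebesgue_rV d) (lebesgue_rV d)
  (fun p => k p.2 * F (p.1 - p.2) * g p.1) (M * N + c) k)//=; last 3 first.
- apply: measurable_funM; last exact: measurableT_comp.
  apply: measurable_funM; first exact: measurableT_comp.
  apply: (measurableT_comp mF); apply: measurable_addrV => //.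
  exact: measurable_opprV.
- move=> x y; rewrite !normrM mulrC mulrDl -[leLHS]addr0 lerD ?mulr_ge0//.
  rewrite mulrCA [leLHS]mulrC; apply: ler_wpM2r => //.
  by rewrite mulrC ler_pM.
- move=> y.
  apply: (@le_trans _ _ (\int[L]_x ((`|k y| * N)%:E * `|F (x - y)|%:E))%E).
    apply: ge0_le_integral => //.
    + apply/measurable_EFinP; apply: measurableT_comp => //.
      apply: measurable_funM => //; apply: measurable_funM => //.
      by apply: (measurableT_comp mF); exact: measurable_translate.
    + apply: measurable_funeM; apply/measurable_EFinP; apply: measurableT_comp => //.
      by apply: (measurableT_comp mF); exact: measurable_translate.
    + move=> x _; rewrite -EFinM lee_fin !normrM -mulrA -mulrA ler_wpM2l//.
      by rewrite mulrC ler_wpM2r.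
  rewrite ge0_integralZl_EFin ?mulr_ge0//; last first.
    apply/measurable_EFinP; apply: measurableT_comp => //.
    by apply: (measurableT_comp mF); exact: measurable_translate.
  rewrite FE; last exact: (integrable_rV_translate (- y) iF).
  rewrite (@Rintegral_rV_translate _ _ (- y) (fun x => `|F x|)); last first.
    exact: integrable_norm.
  rewrite -EFinM lee_fin mulrDl ler_wpDl ?mulr_ge0// /c.
  by rewrite -mulrA mulrC.
(* Meeting point of the two applications of Fubini. *)
transitivity (\int[L]_y \int[L]_z (F z * (k y * g (z + y)))).
  apply: eq_Rintegral => y _.
  have i1 : L.-integrable setT (EFin \o (fun z => F z * (k y * g (z + y)))).
    apply: (@integrableM_bounded _ _ F (fun z => k y * g (z + y)) (`|k y| * N)) => //.
      apply: measurable_funM => //.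
      by apply: (measurableT_comp mg); exact: measurable_translate.
    by move=> z; rewrite normrM ler_wpM2l.
  rewrite -(Rintegral_rV_translate (- y) i1).
  apply: eq_Rintegral => x _; rewrite subrK; ring.
rewrite -(@Rintegral_fubini _ _ _ _ _ (lebesgue_rV d) (lebesgue_rV d)
  (fun p => F p.1 * (k p.2 * g (p.1 + p.2))) (M * N + c) k)//=; last 3 first.
- apply: measurable_funM; first exact: measurableT_comp.
  apply: measurable_funM; first exact: measurableT_comp.
  by apply: (measurableT_comp mg); apply: measurable_addrV.
- move=> x y; rewrite !normrM mulrDl -[leLHS]addr0 lerD ?mulr_ge0//.
  by rewrite mulrCA mulrC ler_wpM2r// ler_pM.
- move=> y.
  apply: (@le_trans _ _ (\int[L]_x ((`|k y| * N)%:E * `|F x|%:E))%E).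
    apply: ge0_le_integral => //.
    + apply/measurable_EFinP; apply: measurableT_comp => //.
      apply: measurable_funM => //; apply: measurable_funM => //.
      by apply: (measurableT_comp mg); exact: measurable_translate.
    + apply: measurable_funeM; apply/measurable_EFinP; exact: measurableT_comp.
    + move=> x _; rewrite -EFinM lee_fin !normrM mulrC ler_wpM2r// ler_wpM2l//.
  rewrite ge0_integralZl_EFin ?mulr_ge0//; last first.
    by apply/measurable_EFinP; apply: measurableT_comp.
  rewrite FE// -EFinM lee_fin mulrDl ler_wpDl ?mulr_ge0// /c.
  by rewrite -mulrA mulrC.
apply: eq_Rintegral => z _; rewrite RintegralZl//.
Qed.

End convolution.

(** * Iterated differences and residuals *)

Section differences.
Context {R : realType} (V : normedZmodType R).
Implicit Types (x y : V) (ys : seq V) (F G w : V -> R) (c rho : R).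

(** Backward rather than forward, since a convolution averages the values
    [F (x - y)]. *)
Definition back_diff y F x := F x - F (x - y).

Definition diffs ys F := foldr back_diff F ys.

Lemma diffs_cat ys ys' F : diffs (ys ++ ys') F = diffs ys (diffs ys' F).
Proof. exact: foldr_cat. Qed.

Lemma diffs_rcons ys y F : diffs (rcons ys y) F = diffs ys (back_diff y F).
Proof. by rewrite -cats1 diffs_cat. Qed.

Lemma diffsD ys F G : diffs ys (fun x => F x + G x) =
  fun x => diffs ys F x + diffs ys G x.
Proof.
elim: ys => [//|y ys /= ->]; apply/funext => x; rewrite /back_diff; ring.
Qed.

Lemma diffsZ ys c F : diffs ys (fun x => c * F x) = fun x => c * diffs ys F x.
Proof.
elim: ys => [//|y ys /= ->]; apply/funext => x; rewrite /back_diff; ring.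
Qed.

Lemma diffs_translate ys F z :
  diffs ys (fun x => F (x - z)) = fun x => diffs ys F (x - z).
Proof.
elim: ys => [//|y ys /= ->]; apply/funext => x; rewrite /back_diff.
by rewrite -!addrA (addrC (- y)).
Qed.

(** Smoothness of order [s] at frequency [rho], localized by the weight [w].
    Only steps up to the wavelength [1 / rho] matter, and each difference is
    measured in units of that wavelength, which makes the notion invariant under
    dilation. *)
Definition diff_bound w rho s c F := forall ys, size ys = s ->
  all (fun y => `|y| <= rho^-1) ys ->
  forall x, `|diffs ys F x| <= c * \prod_(y <- ys) (rho * `|y|) * w x.

End differences.

Section residual.
Context {R : realType} (d : nat).
Local Notation L := (lebesgue_rV d : {measure set 'rV[R]_d -> \bar R}).
Implicit Types (x y z : 'rV[R]_d) (k F G : 'rV[R]_d -> R).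

Definition residual k F x := F x - convolve k F x.

Lemma bounded_measurable_diffs ys F :
  bounded_measurable F -> bounded_measurable (diffs ys F).
Proof.
move=> bF; elim: ys => [//|y ys IH] /=.
by apply: bounded_measurableB => //; exact: bounded_measurable_translate.
Qed.

Lemma bounded_measurable_residual k F : L.-integrable setT (EFin \o k) ->
  bounded_measurable F -> bounded_measurable (residual k F).
Proof.
by move=> ik bF; apply: bounded_measurableB => //; exact: bounded_measurable_convolve.
Qed.

Lemma convolve_diff k F y : L.-integrable setT (EFin \o k) -> bounded_measurable F ->
  back_diff y (convolve k F) = convolve k (back_diff y F).
Proof.
move=> ik bF; apply/funext => x; rewrite /back_diff /convolve -RintegralB//.
- by apply: eq_Rintegral => z _; rewrite mulrBr addrAC.
- exact: integrable_convolve.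
- exact: integrable_convolve.
Qed.

(** Differences commute with convolution. *)
Lemma residual_diffs k F ys : L.-integrable setT (EFin \o k) ->
  bounded_measurable F -> diffs ys (residual k F) = residual k (diffs ys F).
Proof.
move=> ik bF; elim: ys => [//|y ys /= ->]; apply/funext => x.
have := congr1 (@^~ x) (convolve_diff y ik (bounded_measurable_diffs ys bF)).
rewrite /residual /= /back_diff => <-; ring.
Qed.

(** A kernel of mean one turns the residual into an average of first
    differences. *)
Lemma residual_diff k F x : L.-integrable setT (EFin \o k) ->
  \int[L]_y k y = 1 -> bounded_measurable F ->
  residual k F x = \int[L]_y (k y * back_diff y F x).
Proof.
move=> ik k1 bF; rewrite /residual /convolve -[X in X - _]mul1r -k1 -RintegralZr//.
rewrite -RintegralB//.
- by apply: eq_Rintegral => y _; rewrite -mulrBr.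
- exact: (integrableZr measurableT (F x) ik).
- exact: integrable_convolve.
Qed.

Variables (k w : 'rV[R]_d -> R) (rho D : R).
Hypothesis ik : L.-integrable setT (EFin \o k).
Hypothesis k1 : \int[L]_y k y = 1.
Hypothesis rho0 : 0 < rho.
Hypothesis w0 : forall x, 0 <= w x.
Hypothesis wD : forall x y, `|y| <= rho^-1 -> w (x - y) <= D * w x.
Local Notation norm1 := (\int[L]_y `|k y|).

(** The order of smoothness is kept at the cost of a constant, because the
    weight barely changes within the support of [k]. *)
Lemma diff_bound_residual s c F : 0 <= c -> bounded_measurable F ->
  (forall y, k y != 0 -> `|y| <= rho^-1) ->
  diff_bound w rho s c F -> diff_bound w rho s (c * (1 + norm1 * D)) (residual k F).
Proof.
move=> c0 bF kr bd ys ss ay x.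
have bG := bounded_measurable_diffs ys bF.
rewrite residual_diffs// /residual (le_trans (ler_normB _ _))//.
rewrite -!mulrA mulrDl mul1r mulrDr lerD//; first by rewrite mulrA bd.
set p := \prod_(_ <- _) _.
have p0 : 0 <= p by apply: prodr_ge0 => y _; rewrite mulr_ge0// ltW.
apply: (@le_trans _ _ (norm1 * (c * p * (D * w x)))).
  apply: convolve_le => // y /kr yr; apply: (le_trans (bd ys ss ay _)).
  by rewrite ler_wpM2l ?mulr_ge0// wD.
by rewrite le_eqVlt; apply/orP; left; apply/eqP; ring.
Qed.

(** One order of smoothness is spent for a factor [rho * delta], the size of
    the support of [k] in wavelengths. *)
Lemma diff_bound_residual_gain s c delta F : 0 <= c -> bounded_measurable F ->
  delta <= rho^-1 -> (forall y, k y != 0 -> `|y| <= delta) ->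
  diff_bound w rho s.+1 c F ->
  diff_bound w rho s (c * (norm1 * (rho * delta))) (residual k F).
Proof.
move=> c0 bF dr kd bd ys ss ay x.
have bG := bounded_measurable_diffs ys bF.
rewrite residual_diffs// residual_diff//.
set p := \prod_(_ <- _) _.
have p0 : 0 <= p by apply: prodr_ge0 => y _; rewrite mulr_ge0// ltW.
apply: (@le_trans _ _ (norm1 * (c * ((rho * delta) * p) * w x))).
  apply: Rintegral_kernel_le => //.
    have := integrableB measurableT (integrableZr measurableT (diffs ys F x) ik)
      (integrable_convolve x ik bG).
    apply: eq_integrable => // y _ /=.
    by rewrite -EFinM -EFinB -mulrBr.
  move=> y /kd yd; rewrite -[back_diff _ _ _]/(diffs (y :: ys) F x).
  apply: le_trans (bd (y :: ys) _ _ x) _; rewrite /= ?ss//.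
    by rewrite (le_trans yd dr).
  rewrite big_cons ler_wpM2r// ler_wpM2l// ler_wpM2r// ler_wpM2l//.
  exact: ltW.
by rewrite le_eqVlt; apply/orP; left; apply/eqP; ring.
Qed.

End residual.

Section product_rule.
Context {R : realType} (V : normedZmodType R).
Implicit Types (x y : V) (ys : seq V) (F G : V -> R).

Definition diff_bounds (w : V -> R) s c F := forall t, (t <= s)%N ->
  diff_bound w 1 t c F.

Lemma diff_bound1 w t c F : diff_bound w 1 t c F <->
  forall ys, size ys = t -> all (fun y => `|y| <= 1) ys ->
  forall x, `|diffs ys F x| <= c * \prod_(y <- ys) `|y| * w x.
Proof.
split=> h ys ss ay x.
  have := h ys ss; rewrite invr1 => /(_ ay x).
  by under eq_bigr do rewrite mul1r.
rewrite invr1 in ay; under eq_bigr do rewrite mul1r; exact: h.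
Qed.

(** Leibniz rule [back_diff y (F G) = back_diff y F * G + F (. - y) *
    back_diff y G], iterated; [D] pays for the translate of [F]. *)
Lemma diff_boundsM wF wG D s cF cG F G : 0 <= cF -> 0 <= cG -> 0 <= D ->
  (forall x, 0 <= wF x) -> (forall x, 0 <= wG x) ->
  (forall x y, `|y| <= 1 -> wF (x - y) <= D * wF x) ->
  diff_bounds wF s cF F -> diff_bounds wG s cG G ->
  diff_bounds (fun x => wF x * wG x) s ((1 + D) ^+ s * (cF * cG))
    (fun x => F x * G x).
Proof.
move=> cF0 cG0 D0 wF0 wG0 wD bF bG.
suff key t : forall F G cF cG, 0 <= cF -> 0 <= cG ->
    diff_bounds wF t cF F -> diff_bounds wG t cG G ->
    diff_bound (fun x => wF x * wG x) 1 t ((1 + D) ^+ t * (cF * cG))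
    (fun x => F x * G x).
  move=> t ts; have := key t F G cF cG cF0 cG0.
  move=> /(_ (fun u ut => bF u (leq_trans ut ts)) (fun u ut => bG u (leq_trans ut ts))).
  move=> /diff_bound1 h; apply/diff_bound1 => ys ss ay x.
  apply: le_trans (h ys ss ay x) _.
  rewrite -!mulrA ler_wpM2r//; last by rewrite ler_weXn2l// lerDl.
  by rewrite !mulr_ge0// prodr_ge0.
elim: t => [|t IH] {}F {}G {}cF {}cG {}cF0 {}cG0 {}bF {}bG; apply/diff_bound1.
  move=> ys /size0nil -> _ x; rewrite big_nil expr0 mul1r mulr1/= normrM mulrACA.
  have /diff_bound1/(_ [::] erefl erefl x) := bF 0 (leqnn _).
  have /diff_bound1/(_ [::] erefl erefl x) := bG 0 (leqnn _).
  by rewrite big_nil !mulr1/= => hG hF; rewrite ler_pM.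
(* The innermost difference is peeled off, since the Leibniz rule applies
to a product and not to the differences of a product. *)
elim/last_ind => [//|ys y _]; rewrite size_rcons => -[ss].
rewrite all_rcons => /andP[y1 ay] x.
rewrite diffs_rcons big_rcons/=.
have -> : back_diff y (fun x => F x * G x) =
    fun x => back_diff y F x * G x + F (x - y) * back_diff y G x.
  by apply/funext => z; rewrite /back_diff; ring.
rewrite diffsD (le_trans (ler_normD _ _))//.
have sub H w c : diff_bounds w t.+1 c H -> diff_bounds w t c H.
  by move=> h u ut; apply: h; rewrite leqW.
have dsub H w c : diff_bounds w t.+1 c H -> diff_bounds w t (c * `|y|) (back_diff y H).
  move=> h u ut; apply/diff_bound1 => zs ss' az z.
  have /diff_bound1/(_ (rcons zs y)) := h u.+1 ut.
  rewrite size_rcons ss' all_rcons y1 az => /(_ erefl erefl z).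
  by rewrite diffs_rcons big_rcons/=; congr (_ <= _ * _); ring.
have tF : diff_bounds wF t (cF * D) (fun x => F (x - y)).
  move=> u ut; apply/diff_bound1 => zs ss' az z; rewrite diffs_translate.
  have /diff_bound1/(_ zs ss' az (z - y)) := bF u (leqW ut).
  move/le_trans; apply; rewrite -!mulrA ler_wpM2l// mulrCA ler_wpM2l ?prodr_ge0//.
  exact: wD.
have h1 : `|diffs ys (fun x => back_diff y F x * G x) x| <=
    (1 + D) ^+ t * (cF * `|y| * cG) * \prod_(z <- ys) `|z| * (wF x * wG x).
  have /diff_bound1 := IH (back_diff y F) G (cF * `|y|) cG (mulr_ge0 cF0 (normr_ge0 _)) cG0
    (dsub _ _ _ bF) (sub _ _ _ bG).
  exact.
have h2 : `|diffs ys (fun x => F (x - y) * back_diff y G x) x| <=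
    (1 + D) ^+ t * (cF * D * (cG * `|y|)) * \prod_(z <- ys) `|z| * (wF x * wG x).
  have /diff_bound1 := IH (fun x => F (x - y)) (back_diff y G) (cF * D) (cG * `|y|)
    (mulr_ge0 cF0 D0) (mulr_ge0 cG0 (normr_ge0 _)) tF (dsub _ _ _ bG).
  exact.
apply: le_trans (lerD h1 h2) _.
by rewrite exprSr le_eqVlt; apply/orP; left; apply/eqP; ring.
Qed.

End product_rule.

(** * Differences of tensor products of smooth decaying functions *)

Section differences_line.
Context {R : realType}.
Implicit Types (f g : R -> R) (ys : seq R).

Lemma is_derive_diffs f f' ys : (forall x : R, is_derive x (1 : R) f (f' x)) ->
  forall x : R, is_derive x (1 : R) (diffs ys f) (diffs ys f' x).
Proof.
move=> df; elim: ys => [//|y ys IH] /= x; rewrite /back_diff.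
apply: is_deriveB.
have := @is_derive1_comp R (diffs ys f) (fun x => x - y) x _ 1 (IH (x - y)).
rewrite mulr1; apply.
rewrite -[X in is_derive _ _ _ X]subr0; exact: is_deriveB.
Qed.

Lemma diff_mean_value f f' (x y : R) : (forall x : R, is_derive x (1 : R) f (f' x)) ->
  exists2 u : R, (`|u - x| <= `|y|) & (back_diff y f x = y * f' u).
Proof.
move=> df.
have cf : continuous f.
  by move=> z; apply: differentiable_continuous; apply/derivable1_diffP; apply: ex_derive.
have [y0|y0] := leP 0 y.
  have ab : x - y <= x by rewrite gerBl.
  have [u] := MVT_segment ab (fun z _ => df z) (continuous_subspaceT cf).
  rewrite in_itv/= => /andP[u1 u2] E; exists u.
    by rewrite [leRHS]ger0_norm// distrC ger0_norm ?subr_ge0// lerBlDr -lerBlDl.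
  by rewrite /back_diff E; ring.
have ab : x <= x - y by rewrite lerDl oppr_ge0 ltW.
have [u] := MVT_segment ab (fun z _ => df z) (continuous_subspaceT cf).
rewrite in_itv/= => /andP[u1 u2] E; exists u.
  by rewrite [leRHS]ltr0_norm// ger0_norm ?subr_ge0// lerBlDl.
by rewrite /back_diff -opprB E; ring.
Qed.

(** Each difference is a derivative at a nearby point, by the mean value
    theorem; [s] unit steps stay within distance [s]. *)
Lemma diffs_derive1n_le f r s l ys x B :
  (forall l x, (l < r)%N -> derivable (derive1n l f) x 1) ->
  (l + s <= r)%N -> size ys = s -> all (fun y => `|y| <= 1) ys ->
  (forall u, `|u - x| <= s%:R -> `|derive1n (l + s) f u| <= B) ->
  `|diffs ys (derive1n l f) x| <= \prod_(y <- ys) `|y| * B.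
Proof.
move=> df; elim: s l ys x => [|s IH] l ys x ls.
  move/size0nil => -> _ fB; rewrite big_nil mul1r.
  by have := fB x; rewrite addn0 subrr normr0; apply.
case: ys => [//|y ys] /= [ss] /andP[y1 ay] fB.
have dl (z : R) : is_derive z (1 : R) (derive1n l f) (derive1n l.+1 f z).
  split; first by apply: df; rewrite (leq_trans _ ls)// addnS ltnS leq_addr.
  by rewrite derive1nS derive1E.
have [u ux ->] := diff_mean_value x y (is_derive_diffs ys dl).
rewrite big_cons normrM -mulrA ler_wpM2l//.
apply: (IH l.+1) => //; first by rewrite addSnnS.
move=> v vu; rewrite addSnnS; apply: fB.
rewrite -(subrK u v) -addrA (le_trans (ler_normD _ _))// -natr1 lerD//.
exact: le_trans ux y1.
Qed.

(** Quadratic decay makes the derivatives at most a multiple of the weight,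
    and the weight absorbs the shift of the intermediate
    points. *)
Lemma Cr_rapid_decay_diff_bounds r f : Cr_rapid_decay r f ->
  exists2 c, 0 <= c & diff_bounds (@cauchy_weight R) r c f.
Proof.
move=> [df _ decay].
have /choice[C hC] : forall s, exists C, (s <= r)%N ->
    forall u, `|derive1n s f u| <= C * cauchy_weight u.
  move=> s; case: (leqP s r) => [sr|]; last by exists 0.
  have [C hC] := decay s 2%N sr; exists C => _ u.
  rewrite /cauchy_weight ler_pdivlMr ?ltr_pwDl ?sqr_ge0//.
  apply: le_trans (hC u); rewrite ler_wpM2l// -(real_normK (num_real u)).
  have := normr_ge0 u; nra.
(* The first factor moves the weight by a distance at most [r]; the sum
is a common constant for all orders. *)
exists ((1 + r%:R) ^+ 2 * 2 * \sum_(s < r.+1) `|C s|).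
  by rewrite !mulr_ge0// ?sumr_ge0// sqr_ge0.
move=> s sr; apply/diff_bound1 => ys ss ay x.
have := @diffs_derive1n_le f r s 0 ys x
  ((1 + r%:R) ^+ 2 * 2 * (\sum_(s < r.+1) `|C s|) * cauchy_weight x) df sr ss ay.
rewrite add0n => H; apply: le_trans (H _) _; last first.
  by rewrite le_eqVlt; apply/orP; left; apply/eqP; ring.
move=> u us; apply: le_trans (hC s sr u) _.
apply: (@le_trans _ _ ((\sum_(s < r.+1) `|C s|) * cauchy_weight u)).
  rewrite ler_wpM2r// ?(ltW (cauchy_weight_gt0 _))//.
  have srr : (s < r.+1)%N by [].
  rewrite (bigD1 (Ordinal srr))//= (le_trans (ler_norm _))// lerDl sumr_ge0//.
rewrite mulrAC [X in _ <= X]mulrC ler_wpM2l ?sumr_ge0//.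
have -> : u = x - (x - u) by rewrite opprB addrC subrK.
apply: cauchy_weight_shift => //; rewrite distrC (le_trans us)// ler_nat//.
Qed.

End differences_line.

Section differences_tensor.
Context {R : realType} (n : nat).
Implicit Types (x y : 'rV[R]_n).

Lemma diffs_coord (f : R -> R) (i : 'I_n) ys x :
  diffs ys (fun x => f (x ord0 i)) x =
  diffs [seq y ord0 i | y : 'rV[R]_n <- ys] f (x ord0 i).
Proof.
elim: ys x => [//|y ys IH] x /=; rewrite /back_diff !IH.
by rewrite !mxE.
Qed.

Lemma diff_bounds_coord (w f : R -> R) (i : 'I_n) r c : 0 <= c ->
  (forall t, 0 <= w t) -> diff_bounds w r c f ->
  diff_bounds (fun x => w (x ord0 i)) r c (fun x => f (x ord0 i)).
Proof.
move=> c0 w0 bf t tr; apply/diff_bound1 => ys ss ay x; rewrite diffs_coord.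
have /diff_bound1 H := bf t tr.
have := H [seq y ord0 i | y : 'rV[R]_n <- ys]; rewrite size_map => /(_ ss).
have -> : all (fun y : R => `|y| <= 1) [seq y ord0 i | y : 'rV[R]_n <- ys].
  rewrite all_map; apply: sub_all ay => y /=; apply: le_trans.
  exact: coord_le_norm.
move=> /(_ erefl (x ord0 i)) /le_trans; apply.
rewrite ler_wpM2r// ler_wpM2l// big_map; apply: ler_prod => y _.
by rewrite normr_ge0 coord_le_norm.
Qed.

(** The constant [9] is [1 + D] in the product rule, where [D = 8] bounds the
    variation of the weight over a unit step. *)
Lemma diff_bounds_tensor (f : 'I_n -> R -> R) r c : 0 <= c ->
  (forall i, diff_bounds (@cauchy_weight R) r c (f i)) ->
  diff_bounds (@weight R n) r ((9 ^+ r * c) ^+ n)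
    (fun x => \prod_(i < n) f i (x ord0 i)).
Proof.
move=> c0 bf.
have u0 (t : R) : 0 <= cauchy_weight t by exact/ltW/cauchy_weight_gt0.
suff key s : diff_bounds (fun x => \prod_(i <- s) cauchy_weight (x ord0 i)) r
    ((9 ^+ r * c) ^+ size s) (fun x : 'rV[R]_n => \prod_(i <- s) f i (x ord0 i)).
  have := key (index_enum 'I_n).
  have -> : size (index_enum 'I_n) = n by rewrite -sum1_size sum1_card card_ord.
  exact.
elim: s => [|i s IH].
  have -> : (fun x : 'rV[R]_n => \prod_(i <- [::]) f i (x ord0 i)) = cst 1.
    by apply/funext => x; rewrite big_nil.
  rewrite expr0.
  move=> t _; apply/diff_bound1; elim/last_ind => [|ys y _] _ _ x.
    by rewrite /= !big_nil !mulr1 normr1.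
  have dz zs : diffs zs (fun=> 0) = (fun=> 0) :> ('rV[R]_n -> R).
    by elim: zs => [//|z zs /= ->]; apply/funext => z'; rewrite /back_diff subrr.
  have dy : back_diff y (cst 1) = (fun=> 0) :> ('rV[R]_n -> R).
    by apply/funext => z; rewrite /back_diff subrr.
  rewrite diffs_rcons.
  rewrite [X in diffs ys X]dy dz normr0 big_nil mulr1 mul1r.
  by apply: prodr_ge0.
have H := @diff_boundsM R 'rV[R]_n (fun x => cauchy_weight (x ord0 i))
  (fun x => \prod_(j <- s) cauchy_weight (x ord0 j)) 8 r c
  ((9 ^+ r * c) ^+ size s) (fun x => f i (x ord0 i))
  (fun x => \prod_(j <- s) f j (x ord0 j)) c0.
have h9 : 0 <= (9 ^+ r * c) ^+ size s by rewrite exprn_ge0// mulr_ge0// exprn_ge0.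
move: H => /(_ h9) H t tr.
have w1 (x y : 'rV[R]_n) : `|y| <= 1 ->
    cauchy_weight ((x - y) ord0 i) <= 8 * cauchy_weight (x ord0 i).
  move=> y1; rewrite !mxE.
  have := @cauchy_weight_shift R 1 (x ord0 i) (y ord0 i).
  rewrite (_ : (1 + 1) ^+ 2 * 2 = 8 :> R); last by ring.
  by apply => //; apply: le_trans y1; exact: coord_le_norm.
have wp (x : 'rV[R]_n) : 0 <= \prod_(j <- s) cauchy_weight (x ord0 j).
  exact: prodr_ge0.
have := H (ler0n _ _) (fun x => u0 _) wp w1
  (diff_bounds_coord i c0 u0 (bf i)) IH t tr.
rewrite /= exprS mulrA (_ : 1 + 8 = 9 :> R); last by ring.
have -> : (fun x : 'rV[R]_n => \prod_(j <- i :: s) f j (x ord0 j)) =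
    (fun x => f i (x ord0 i) * \prod_(j <- s) f j (x ord0 j)).
  by apply/funext => x; rewrite big_cons.
have -> // : (fun x : 'rV[R]_n => \prod_(j <- i :: s) cauchy_weight (x ord0 j)) =
    (fun x => cauchy_weight (x ord0 i) * \prod_(j <- s) cauchy_weight (x ord0 j)).
by apply/funext => x; rewrite big_cons.
Qed.

Lemma diffs_rescale rho (k : 'rV[R]_n) (G : 'rV[R]_n -> R) ys x :
  diffs ys (fun x => G (rho *: x - k)) x =
  diffs [seq rho *: y | y <- ys] G (rho *: x - k).
Proof.
elim: ys x => [//|y ys IH] x /=; rewrite /back_diff !IH.
by rewrite scalerBr addrAC.
Qed.

Lemma diff_bound_rescale rho (k : 'rV[R]_n) w G s a c : 0 < rho -> 0 <= a ->
  diff_bound w 1 s c G ->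
  diff_bound (fun x => w (rho *: x - k)) rho s (a * c)
    (fun x => a * G (rho *: x - k)).
Proof.
move=> rho0 a0 /diff_bound1 bG ys ss ay x.
rewrite diffsZ diffs_rescale normrM ger0_norm// -!mulrA ler_wpM2l//.
have := bG [seq rho *: y | y <- ys].
rewrite size_map => /(_ ss).
have -> : all (fun y : 'rV[R]_n => `|y| <= 1) [seq rho *: y | y <- ys].
  rewrite all_map; apply: sub_all ay => y /=.
  by rewrite normrZ gtr0_norm// -ler_pdivlMl// mulr1.
move=> /(_ erefl (rho *: x - k)); rewrite big_map -mulrA.
by under eq_bigr do rewrite normrZ gtr0_norm//.
Qed.

End differences_tensor.

(** * The generating kernel *)

Section kernel.
Context {R : realType} (d : nat).
Local Notation L := (lebesgue_rV d : {measure set 'rV[R]_d -> \bar R}).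
Implicit Types (x y z h : 'rV[R]_d) (G K : 'rV[R]_d -> R).

Lemma continuous_unit_cube_bounded G : continuous G ->
  (forall x, G x != 0 -> unit_cube d x) ->
  exists2 B, 0 <= B & forall x, `|G x| <= B.
Proof.
move=> cG G01.
have cQ : compact [set x : 'rV[R]_d | forall i, `[0, 1]%classic (x ord0 i)].
  exact: (@rV_compact R d (fun=> `[0, 1]%classic) (fun=> @segment_compact R 0 1)).
have /compact_bounded[M [Mr MB]] := continuous_compact (continuous_subspaceT cG) cQ.
exists (`|M| + 1); first by rewrite addr_ge0.
move=> x; have [->|/G01 x01] := eqVneq (G x) 0; first by rewrite normr0 addr_ge0.
have MM : M < `|M| + 1 by rewrite ltr_pwDr// ler_norm.
apply: (MB _ MM (G x)); exists x => // i; rewrite /= in_itv/=.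
by have /andP[-> /ltW ->] := x01 i.
Qed.

Lemma unit_cube_norm x : unit_cube d x -> `|x| <= 1.
Proof.
move=> x01; apply: norm_rV_le => // i.
by have /andP[x0 /ltW x1] := x01 i; rewrite ger0_norm.
Qed.

Lemma measurable_norm_le (r : R) : measurable [set x : 'rV[R]_d | `|x| <= r].
Proof.
rewrite (_ : [set _ | _] = (fun x : 'rV[R]_d => `|x|) @^-1` `]-oo, r]%classic); last first.
  by apply/seteqP; split => x /=; rewrite in_itv.
rewrite -[X in measurable X]setTI.
by apply: (continuous_measurable_rV (@norm_continuous _ _)).
Qed.

Lemma lebesgue_rV_norm_le_lty (r : R) : (L [set x | (`|x| <= r)%R] < +oo)%E.
Proof.
apply: (@le_lt_trans _ _ (L (rV_box (fun=> `[- r, r]%classic)))).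
  rewrite le_measure ?inE//.
  - exact: measurable_norm_le.
  - exact: measurable_rV_box.
  - by move=> x /= xr i /=; rewrite in_itv/= -ler_norml (le_trans (coord_le_norm _ _)).
rewrite ltey_eq; apply/orP; left.
have /= := @lebesgue_rV_prod R d (fun=> `[- r, r]%classic).
rewrite /rV_box => ->//.
elim/big_ind : _ => // [x y fx fy|i _]; first exact: fin_numM.
by rewrite lebesgue_measure_itv/=; case: ifP.
Qed.

Lemma integral_bounded_support G r B : 0 <= B -> measurable_fun setT G ->
  (forall x, `|G x| <= B) -> (forall x, G x != 0 -> `|x| <= r) ->
  (\int[L]_x `|G x|%:E <= B%:E * L [set x | (`|x| <= r)%R])%E.
Proof.
move=> B0 mG GB Gr.
rewrite -integral_cst//; last exact: measurable_norm_le.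
rewrite [leRHS]integral_mkcond ge0_le_integral//.
- by apply/measurable_EFinP; exact: measurableT_comp.
- apply/(measurable_restrictT _ (measurable_norm_le r)).
  exact: measurable_cst.
- move=> x _; rewrite patchE.
  case: ifPn => [_|xr]; first by rewrite lee_fin.
  have [->|/Gr h] := eqVneq (G x) 0; first by rewrite normr0.
  by move: xr; rewrite mem_set.
Qed.

Lemma bounded_support_integrable G r B : measurable_fun setT G ->
  (forall x, `|G x| <= B) -> (forall x, G x != 0 -> `|x| <= r) ->
  L.-integrable setT (EFin \o G).
Proof.
move=> mG GB Gr; apply/integrableP; split; first exact/measurable_EFinP.
have B0 : 0 <= B by apply: le_trans (GB 0).
apply: le_lt_trans (integral_bounded_support B0 mG GB Gr) _.
by rewrite lte_mul_pinfty// lebesgue_rV_norm_le_lty.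
Qed.

Variable K : 'rV[R]_d -> R.
Hypothesis mK : multiscale_kernel K.

Lemma kernel_continuous : continuous K.
Proof. by have [] := kernel_smooth mK [::]. Qed.

Lemma kernel_measurable : measurable_fun setT K.
Proof. by apply: continuous_measurable_rV; exact: kernel_continuous. Qed.

Lemma kernel_supp x : K x != 0 -> unit_cube d x.
Proof. by move=> Kx; apply: (kernel_support mK); exact: subset_closure. Qed.

Lemma kernel_bounded : exists2 B, 0 <= B & forall x, `|K x| <= B.
Proof.
by apply: continuous_unit_cube_bounded; [exact: kernel_continuous|exact: kernel_supp].
Qed.

Lemma kernel_integrable : L.-integrable setT (EFin \o K).
Proof.
have [B _ KB] := kernel_bounded.
apply: (bounded_support_integrable (r := 1) kernel_measurable KB) => x.
by move=> /kernel_supp; exact: unit_cube_norm.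
Qed.

(** The Fourier condition at frequency zero. *)
Lemma kernel_mean_neq0 : \int[L]_x K x != 0.
Proof.
have d0 x : dot (0 : 'rV[R]_d) x = 0.
  by rewrite /dot big1// => i _; rewrite mxE mul0r.
have /(_ 0) := kernel_fourier mK; rewrite d0 sqrtr0 => /(_ (ltr0n _ 2)).
rewrite normr_gt0 /fourier.
under eq_Rintegral do rewrite d0 mulr0 oppr0 cos0 mulr1.
under [X in Complex _ X]eq_Rintegral do rewrite d0 mulr0 oppr0 sin0 mulr0.
apply: contra => /eqP ->.
by rewrite /Rintegral integral0.
Qed.

(** The partial derivatives vanish off the closure of the set where [K] is
    nonzero, hence off the unit cube, and they are continuous. *)
Lemma kernel_partial_bounded :
  exists2 B, 0 <= B & forall i x, `|'D_(delta_mx ord0 i) K x| <= B.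
Proof.
have supp i x : 'D_(delta_mx ord0 i) K x != 0 -> unit_cube d x.
  move=> Dx; apply: (kernel_support mK); apply: contrapT => xK.
  move/eqP: Dx; apply.
  have oC : open (~` closure [set x | K x != 0]).
    exact/closed_openC/closed_closure.
  rewrite (near_eq_derive (g := cst 0)).
  - exact: derive_cst.
  - near=> y; apply/eqP/negPn/negP => Ky.
    suff : (~` closure [set x | K x != 0]) y by apply; exact: subset_closure.
    by near: y; apply: open_nbhs_nbhs.
have /choice[B hB] : forall i, exists B, 0 <= B /\
    forall x, `|'D_(delta_mx ord0 i) K x| <= B.
  move=> i; have [cD _] := kernel_smooth mK [:: i].
  by have [B B0 hB] := continuous_unit_cube_bounded cD (supp i); exists B.
exists (\sum_i B i); first by rewrite sumr_ge0// => i _; have [] := hB i.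
move=> i x; have [Bi /(_ x) hi] := hB i; apply: (le_trans hi).
by rewrite (bigD1 i)//= lerDl sumr_ge0// => j _; have [] := hB j.
Unshelve. all: by end_near.
Qed.

(** Move one coordinate at a time. *)
Lemma kernel_Lipschitz : exists2 B, 0 <= B &
  forall x h, `|K x - K (x - h)| <= B * `|h|.
Proof.
have [B B0 DB] := kernel_partial_bounded.
have step z i (t : R) : `|K z - K (z - t *: delta_mx ord0 i)| <= B * `|t|.
  pose f (s : R) := K (z + s *: delta_mx ord0 i).
  have df (s : R) : is_derive s (1 : R) f ('D_(delta_mx ord0 i) K (z + s *: delta_mx ord0 i)).
    have [_ dK] := kernel_smooth mK [::].
    have E : (fun h : R => h^-1 *: ((f \o shift s) (h *: 1) - f s)) =
      (fun h : R => h^-1 *: ((K \o shift (z + s *: delta_mx ord0 i))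
        (h *: delta_mx ord0 i) - K (z + s *: delta_mx ord0 i))).
      apply/funext => h; rewrite /f /=; congr (_ *: (K _ - _)).
      by rewrite [h%:A]mulr1 scalerDl addrCA.
    split; first by have := dK i (z + s *: delta_mx ord0 i); rewrite /derivable E.
    by rewrite /derive E.
  have [u _] := diff_mean_value 0 t df.
  rewrite /back_diff /f scale0r addr0 sub0r scaleNr => ->.
  by rewrite normrM mulrC ler_wpM2r.
exists (B * d%:R); first by rewrite mulr_ge0.
move=> x h.
have -> : K (x - h) = K (x - \sum_i h ord0 i *: delta_mx ord0 i).
  by rewrite -row_sum_delta.
have -> : B * d%:R * `|h| = \sum_(i < d) B * `|h|.
  by rewrite sumr_const card_ord -[RHS]mulr_natr; ring.
elim: (index_enum _) => [|i s IH]; first by rewrite !big_nil subr0 subrr normr0.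
rewrite !big_cons opprD [- _ - _]addrC addrA.
set z := x - \sum_(j <- s) _.
rewrite -[X in `|X|](subrKA (K z)) (le_trans (ler_normD _ _))// [leRHS]addrC lerD//.
by rewrite (le_trans (step _ _ _))// ler_wpM2l// coord_le_norm.
Qed.

(** The difference is supported in the ball of radius [3 = 1 + 2]. *)
Lemma kernel_L1_Lipschitz : exists2 B, 0 <= B &
  forall h, `|h| <= 2 -> \int[L]_x `|K x - K (x - h)| <= B * `|h|.
Proof.
have [B B0 KB] := kernel_Lipschitz.
pose V := fine (L [set x | `|x| <= 3]).
have VE : L [set x | `|x| <= 3] = V%:E.
  by rewrite fineK// ge0_fin_numE// lebesgue_rV_norm_le_lty.
exists (B * V); first by rewrite mulr_ge0// fine_ge0.
move=> h h2; set G := fun x => K x - K (x - h).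
have mG : measurable_fun setT G.
  apply: measurable_funB; first exact: kernel_measurable.
  by apply: (measurableT_comp kernel_measurable); exact: measurable_translate.
have Gr x : G x != 0 -> `|x| <= 3.
  move=> Gx; have [Kx|/kernel_supp/unit_cube_norm x1] := eqVneq (K x) 0; last first.
    by rewrite (le_trans x1)// ler1n.
  have : K (x - h) != 0 by apply: contraNneq Gx => E; rewrite /G Kx E subrr.
  move=> /kernel_supp/unit_cube_norm xh1.
  by rewrite -(subrK h x) (le_trans (ler_normD _ _))// (_ : 3 = 1 + 2) ?lerD//; ring.
have iG := bounded_support_integrable mG (KB^~ h) Gr.
rewrite -lee_fin /Rintegral fineK; last first.
  by apply: integrable_fin_num => //; exact: (integrable_norm iG).
apply: le_trans (integral_bounded_support _ mG (KB^~ h) Gr) _.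
  by rewrite mulr_ge0.
by rewrite VE -EFinM lee_fin le_eqVlt; apply/orP; left; apply/eqP; ring.
Qed.

End kernel.

(** * The atoms and their coefficients *)

Section atoms.
Context {R : realType} (d m : nat).
Local Notation L := (lebesgue_rV d : {measure set 'rV[R]_d -> \bar R}).
Local Notation T := (torus_measure d : {measure set 'rV[R]_d -> \bar R}).
Local Notation "l %:V" := (map_mx intr l : 'rV[R]_d) (at level 2).
Implicit Types (x y z : 'rV[R]_d) (g : 'rV[R]_d -> R).
Variable K : 'rV[R]_d -> R.
Hypothesis mK : multiscale_kernel K.
Hypothesis m2 : (2 <= m)%N.

Local Notation M := (m%:R : R).
Local Notation kappa := (\int[L]_x K x).

Definition atom_height (j : nat) : R := m%:R `^ (j%:R * d%:R / 2).

(** The atom before periodization. *)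
Definition line_atom j z := fun x => atom_height j * K (M ^+ j *: (x - z)).

(** An approximate identity built from [K]: its mean is one. *)
Definition mean_kernel j := fun y => kappa^-1 * (M ^+ j) ^+ d * K (M ^+ j *: y).

Let M0 : 0 < M. Proof. by rewrite ltr0n (leq_trans _ m2). Qed.
Let Mj0 j : 0 < M ^+ j. Proof. by rewrite exprn_gt0. Qed.

Lemma atom_height_gt0 j : 0 < atom_height j. Proof. exact: powR_gt0. Qed.

Lemma atom_height_sqr j : atom_height j ^+ 2 = (M ^+ j) ^+ d.
Proof.
rewrite -powR_mulrn ?powR_ge0// /atom_height -powRrM -exprM -powR_mulrn ?ltW//.
by congr (_ `^ _); rewrite natrM; field.
Qed.

Lemma line_atomE j z x :
  line_atom j z x = atom_height j * K (M ^+ j *: x + - (M ^+ j *: z)).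
Proof. by rewrite /line_atom scalerBr. Qed.

Lemma line_atom_integrable j z : L.-integrable setT (EFin \o line_atom j z).
Proof.
have := integrableZl measurableT (atom_height j)
  (integrable_rV_affine (- (M ^+ j *: z)) (Mj0 j) (kernel_integrable mK)).
by apply: eq_integrable => // x _ /=; rewrite line_atomE EFinM.
Qed.

Lemma line_atom_measurable j z : measurable_fun setT (line_atom j z).
Proof. by have /integrableP[/measurable_EFinP] := line_atom_integrable j z. Qed.

(** The support of the atom lies in a translate of the unit cube, as
    [m ^ j >= 1], and the integer translates of that cube are disjoint. *)
Lemma line_atom_disjoint j z x (k l : 'rV[int]_d) :
  line_atom j z (x + k%:V) != 0 -> line_atom j z (x + l%:V) != 0 -> k = l.
Proof.
have aux n : line_atom j z (x + n%:V) != 0 -> floorV (x - z) = - n.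
  rewrite /line_atom mulf_eq0 negb_or => /andP[_ /(kernel_supp mK) h].
  apply/unit_cube_floorV => i; have := h i; rewrite intV_opp !mxE opprK addrAC.
  set t := (_ - _ + _) => /andP[t0 t1].
  have t0' : 0 <= t by rewrite -(pmulr_rge0 _ (Mj0 j)).
  have Mj1 : 1 <= M ^+ j by rewrite exprn_ege1// ler1n (leq_trans _ m2).
  by rewrite t0'/= (le_lt_trans _ t1)// ler_peMl.
by move=> /aux E /aux; rewrite E => /oppr_inj.
Qed.

Lemma multiscale_atomE j z : multiscale_atom m K (j, z) = periodize (line_atom j z).
Proof. by []. Qed.

Lemma line_atom_norm2 j z : ('N[L]_2%:E[EFin \o line_atom j z] = 1)%E.
Proof.
rewrite -(kernel_norm2 mK) !Lnorm2E; congr (_ `^ _)%E.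
have mK2 : measurable_fun setT (fun x => (K x ^+ 2)%:E).
  by apply/measurable_EFinP; apply: measurable_funX; exact: kernel_measurable.
have K20 x : (0 <= (K x ^+ 2)%:E)%E by rewrite lee_fin sqr_ge0.
transitivity (\int[L]_x (((M ^+ j) ^+ d)%:E *
    (K (M ^+ j *: x + - (M ^+ j *: z))%R ^+ 2)%:E))%E.
  by apply: eq_integral => x _; rewrite line_atomE exprMn atom_height_sqr EFinM.
rewrite ge0_integralZl_EFin//.
- rewrite (ge0_integral_rV_affine (- (M ^+ j *: z)) (Mj0 j) mK2 K20).
  by rewrite muleA -EFinM divff ?mul1e// expf_neq0// gt_eqF.
- by apply: (measurableT_comp mK2); exact: measurable_affine.
Qed.

Lemma atom_normalized (w : nat * 'rV[R]_d) :
  torus_Lp 2%:E (multiscale_atom m K w) /\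
  torus_norm 2%:E (multiscale_atom m K w) = 1%E.
Proof.
case: w => j z.
have N1 : torus_norm 2%:E (multiscale_atom m K (j, z)) = 1%E.
  rewrite multiscale_atomE torus_norm2_periodize ?line_atom_norm2//.
  - exact: line_atom_measurable.
  - by move=> x k l; exact: line_atom_disjoint.
split => //; split; first exact: periodic_periodize.
rewrite inE; apply/andP; split; rewrite inE /=.
  by apply: measurable_periodize; exact: line_atom_measurable.
by rewrite /finite_norm -/(torus_norm _ _) N1 ltry.
Qed.

Section inner.
Variables (g : 'rV[R]_d -> R) (N : R).
Hypotheses (mg : measurable_fun setT g) (pg : periodic g) (gN : forall x, `|g x| <= N).

Definition atom_coef j z := torus_inner (multiscale_atom m K (j, z)) g.

Lemma atom_coefE j z : atom_coef j z = \int[L]_x (line_atom j z x * g x).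
Proof.
exact: (torus_inner_periodize (line_atom_integrable j z) mg pg gN).
Qed.

(** In this form the position [z] acts on [g] alone, which shows both the
    periodicity in [z] and that the coefficient is a correlation. *)
Lemma atom_coef_centered j z :
  atom_coef j z = \int[L]_y (atom_height j * K (M ^+ j *: y) * g (z + y)).
Proof.
rewrite atom_coefE -(Rintegral_rV_translate z); last first.
  exact: (integrableM_bounded (line_atom_integrable j z) mg gN).
by apply: eq_Rintegral => y _; rewrite /line_atom addrK addrC.
Qed.

Lemma atom_coef_periodic j z (l : 'rV[int]_d) : atom_coef j (z + l%:V) = atom_coef j z.
Proof.
rewrite !atom_coef_centered; apply: eq_Rintegral => y _; congr (_ * _).
by rewrite addrAC pg.
Qed.

Lemma mean_kernel_integrable j : L.-integrable setT (EFin \o mean_kernel j).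
Proof.
have := integrableZl measurableT (kappa^-1 * (M ^+ j) ^+ d)
  (integrable_rV_affine 0 (Mj0 j) (kernel_integrable mK)).
by apply: eq_integrable => // x _ /=; rewrite addr0 EFinM.
Qed.

Lemma mean_kernel_mean j : \int[L]_y mean_kernel j y = 1.
Proof.
have i1 := integrable_rV_affine 0 (Mj0 j) (kernel_integrable mK).
have := Rintegral_rV_affine 0 (Mj0 j) (kernel_integrable mK).
under eq_Rintegral do rewrite addr0.
move=> E; rewrite /mean_kernel RintegralZl//; last first.
  by move: i1; under eq_fun do rewrite addr0.
rewrite E; field; rewrite kernel_mean_neq0//=.
by rewrite expf_neq0 ?gt_eqF.
Qed.

Lemma mean_kernel_norm1 j :
  \int[L]_y `|mean_kernel j y| = `|kappa|^-1 * \int[L]_x `|K x|.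
Proof.
have iK := integrable_norm (kernel_integrable mK).
have i1 := integrable_rV_affine 0 (Mj0 j) iK.
have E := Rintegral_rV_affine 0 (Mj0 j) iK.
transitivity (\int[L]_y ((`|kappa|^-1 * (M ^+ j) ^+ d) * `|K (M ^+ j *: y + 0)|)).
  apply: eq_Rintegral => y _; rewrite /mean_kernel addr0 !normrM normfV.
  by rewrite (@ger0_norm _ ((M ^+ j) ^+ d))// exprn_ge0// ltW.
rewrite RintegralZl// E; field.
by rewrite normr_eq0 kernel_mean_neq0//= expf_neq0 ?gt_eqF.
Qed.

Lemma mean_kernel_supp j y : mean_kernel j y != 0 -> `|y| <= (M ^+ j)^-1.
Proof.
rewrite /mean_kernel mulf_eq0 negb_or => /andP[_ /(kernel_supp mK)].
move/unit_cube_norm; rewrite normrZ gtr0_norm//.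
by rewrite -[_^-1]mul1r ler_pdivlMr// mulrC.
Qed.

(** The link between convolution by [mean_kernel j] and the dictionary. *)
Lemma mean_kernel_coef j z :
  \int[L]_y (mean_kernel j y * g (z + y)) =
  kappa^-1 * atom_height j * atom_coef j z.
Proof.
have ig : L.-integrable setT
    (EFin \o (fun y => atom_height j * K (M ^+ j *: y) * g (z + y))).
  apply: (@integrableM_bounded _ _ (fun y => atom_height j * K (M ^+ j *: y))
    (fun y => g (z + y)) N) => //; last first.
    by apply: (measurableT_comp mg); apply: measurable_addrV.
  have := line_atom_integrable j 0; rewrite /line_atom.
  by under eq_fun do rewrite subr0.
rewrite atom_coef_centered -RintegralZl//.
apply: eq_Rintegral => y _; rewrite /mean_kernel -atom_height_sqr; ring.
Qed.

(** The L^1 modulus of continuity of [K], read at scale [m ^ - j]; the height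
    of the atom times its volume is the inverse of the height. *)
Lemma atom_coef_translate B j z z' : 0 <= B ->
  (forall h, `|h| <= 2 -> \int[L]_x `|K x - K (x - h)| <= B * `|h|) ->
  M ^+ j * `|z' - z| <= 2 ->
  `|atom_coef j z - atom_coef j z'| <=
  N * B * ((atom_height j)^-1 * (M ^+ j * `|z' - z|)).
Proof.
move=> B0 KB zz.
have N0 : 0 <= N by apply: le_trans (gN 0).
have iK := kernel_integrable mK.
pose h := M ^+ j *: (z' - z).
have hE : `|h| = M ^+ j * `|z' - z| by rewrite normrZ gtr0_norm.
have iKh : L.-integrable setT (EFin \o (fun x => K x - K (x - h))).
  have := integrableB measurableT iK (integrable_rV_translate (- h) iK).
  exact.
have inKh := integrable_norm iKh.
have i1 := integrable_rV_affine (- (M ^+ j *: z)) (Mj0 j) inKh.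
have E := Rintegral_rV_affine (- (M ^+ j *: z)) (Mj0 j) inKh.
have ia y := integrableM_bounded (line_atom_integrable j y) mg gN.
rewrite !atom_coefE -RintegralB//.
have i2 := integrableB measurableT (ia z) (ia z').
apply: le_trans (le_normr_Rintegral measurableT _) _; first exact: i2.
apply: (@le_trans _ _ (\int[L]_x (N * atom_height j *
   `|K (M ^+ j *: x + - (M ^+ j *: z)) - K (M ^+ j *: x + - (M ^+ j *: z) - h)|))).
  apply: le_Rintegral => //.
  - exact: (integrable_norm i2).
  - exact: (integrableZl measurableT (N * atom_height j) i1).
  move=> x _; rewrite -mulrBl normrM mulrC -mulrA ler_pM//.
  rewrite /line_atom -mulrBr normrM gtr0_norm ?atom_height_gt0//.
  rewrite le_eqVlt; apply/orP; left; apply/eqP; congr (_ * `|K _ - K _|).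
    by rewrite scalerBr.
  by rewrite /h !scalerBr opprB addrA subrK.
rewrite (@RintegralZl _ _ _ L setT _ (N * atom_height j) measurableT i1) E.
rewrite -hE -/h.
apply: (@le_trans _ _ (N * atom_height j * ((M ^+ j) ^- d * (B * `|h|)))).
  rewrite ler_wpM2l ?mulr_ge0 ?(ltW (atom_height_gt0 _))//.
  by rewrite ler_wpM2l ?invr_ge0 ?exprn_ge0 ?(ltW M0)// KB// hE.
rewrite -atom_height_sqr le_eqVlt; apply/orP; left; apply/eqP.
by field; rewrite gt_eqF ?atom_height_gt0.
Qed.

End inner.

End atoms.

(** * Grids, scales and cardinalities *)

Section grids.
Context {R : realType} (d m : nat).
Implicit Types (x y z : 'rV[R]_d).
Hypothesis m2 : (2 <= m)%N.
Hypothesis d1 : (1 <= d)%N.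
Local Notation M := (m%:R : R).
Local Notation Gamma := (Num.max 1 (d%:R / 2) : R).

Let M0 : 0 < M. Proof. by rewrite ltr0n (leq_trans _ m2). Qed.
Let M1 : 1 < M. Proof. by rewrite ltr1n. Qed.

(** As [m ^ r] need not be an integer, the grid has as many points in each
    direction as the integer part of [m ^ r]. *)
Definition grid_size (r : R) : nat := Num.truncn (M `^ r).

Definition grid_point (r : R) (k : {ffun 'I_d -> 'I_(grid_size r)}) : 'rV[R]_d :=
  \row_i ((k i)%:R * M `^ (- r)).

Lemma gridE r : @grid R d m r = range (@grid_point r).
Proof.
have P0 : 0 <= M `^ r by exact: powR_ge0.
apply/seteqP; split => [x [k hk]|_ [k _ <-]]; last first.
  exists (fun i => (k i)%:Z) => i; rewrite mxE; split => //.
  rewrite lerBrDr (natr1 (k i)).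
  by rewrite -truncn_gt_nat ltn_ord.
have kr i : (`|k i|%N < grid_size r)%N.
  have [k0 kP _] := hk i; rewrite truncn_gt_nat -natr1 -lerBrDr.
  by apply: le_trans kP; rewrite natr_absz ger0_norm.
exists [ffun i => Ordinal (kr i)] => //.
apply/rowP => i; rewrite mxE ffunE/=; have [k0 _ ->] := hk i.
by rewrite natr_absz ger0_norm.
Qed.

Lemma grid_point_inj r : injective (@grid_point r).
Proof.
move=> k l /rowP kl; apply/ffunP => i; apply/val_inj/eqP.
have := kl i; rewrite !mxE => /(mulIf _) => /(_ _)/eqP.
by rewrite eqr_nat; apply; rewrite gt_eqF ?powR_gt0.
Qed.

(** The last grid point may be at distance up to [2 m ^ - r] from the right
    end of the interval, because [m ^ r] need not be an integer. *)
Lemma grid_dense r z : 0 <= r -> unit_cube d z ->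
  exists2 k, @grid R d m r k & `|z - k| <= 2 * M `^ (- r).
Proof.
move=> r0 z01.
have P0 : 0 < M `^ r by exact: powR_gt0.
have P1 : 1 <= M `^ r by rewrite -[leLHS](powRr0 M) ler_powR ?(ltW M1).
(* The grid point just below [z], or the last one if that would fall
off the grid. *)
pose k i : int := Order.min (Num.floor (z ord0 i * M `^ r)) (Num.floor (M `^ r) - 1).
have fP : (1 <= Num.floor (M `^ r))%R by rewrite floor_ge_int.
exists (\row_i ((k i)%:~R * M `^ (- r))).
  exists k => i; rewrite mxE; split => //.
    rewrite /k le_min subr_ge0 fP andbT floor_ge_int mulr_ge0 ?(ltW P0)//.
    by have /andP[] := z01 i.
  apply: (@le_trans _ _ ((Num.floor (M `^ r) - 1)%:~R)).
    by rewrite ler_int /k ge_min lexx orbT.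
  by rewrite intrB lerB// floor_le.
have Pi0 : 0 <= M `^ (- r) by exact: powR_ge0.
apply: norm_rV_le; first by rewrite mulr_ge0.
move=> i; rewrite !mxE.
have zE : z ord0 i = z ord0 i * M `^ r * M `^ (- r).
  by rewrite powRN mulfK// gt_eqF.
rewrite zE -mulrBl normrM (ger0_norm Pi0) ler_wpM2r//.
set t := z ord0 i * M `^ r.
have /andP[z0 z1] := z01 i.
have tP : t < M `^ r by rewrite /t gtr_pMl.
have t1 := floor_le t.
have t2 := floorD1_gt t.
have p2 := floorD1_gt (M `^ r).
rewrite intrD in t2 p2.
rewrite /k -/t minEle; case: ifP => ck.
  by rewrite ger0_norm ?subr_ge0//; lra.
have ck' : (Num.floor (M `^ r) - 1)%:~R <= (Num.floor t)%:~R :> R.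
  by rewrite ler_int ltW// ltNge ck.
rewrite intrB in ck'; rewrite intrB ger0_norm; last by lra.
lra.
Qed.

Local Notation J := (@scale_count R d m).

Lemma scale_countP n : (m ^ d <= n)%N ->
  (0 < J n)%N /\ M ^+ (J n * d) <= n%:R < M ^+ ((J n).+1 * d).
Proof.
move=> mn.
have n0 : 0 < n%:R :> R by rewrite ltr0n (leq_trans _ mn)// expn_gt0 (leq_trans _ m2).
have lM : 0 < ln M by rewrite ln_gt0.
have d0 : 0 < d%:R :> R by rewrite ltr0n.
set t : R := d%:R^-1 * (ln n%:R / ln M).
have tE : t * (d%:R * ln M) = ln n%:R.
  by rewrite /t; field; rewrite !gt_eqF.
have t1 : 1 <= t.
  rewrite -(ler_pM2r (mulr_gt0 d0 lM)) tE mul1r.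
  rewrite mulrC mulr_natr -lnXn// ler_ln ?posrE ?exprn_gt0//.
  by rewrite -natrX ler_nat.
have /andP[h1 h2] := truncn_itv (le_trans ler01 t1).
rewrite -/(J n) in h1 h2.
split; first by rewrite truncn_gt0.
have lnX k : ln (M ^+ (k * d)) = k%:R * (d%:R * ln M).
  by rewrite lnXn// -[LHS]mulr_natr natrM; ring.
apply/andP; split.
  rewrite -ler_ln ?posrE ?exprn_gt0// lnX -tE.
  by rewrite ler_wpM2r// mulr_ge0 ?ltW.
by rewrite -ltr_ln ?posrE ?exprn_gt0// lnX -tE ltr_pM2r// mulr_gt0.
Qed.

Definition index_point n
    (p : 'I_(J n) * {ffun 'I_d -> 'I_(grid_size (@grid_exponent R d m n))}) :
  nat * 'rV[R]_d := (val p.1, grid_point p.2).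

Lemma multiscale_index_E n : @multiscale_index_ R d m n = range (@index_point n).
Proof.
rewrite /multiscale_index_ gridE; apply/seteqP; split.
  by move=> [j z] /= [jJ [k _ <-]]; exists (Ordinal jJ, k).
by move=> _ [[j k] _ <-] /=; split => //; exists k.
Qed.

Lemma index_point_inj n : injective (@index_point n).
Proof.
by move=> [j k] [j' k'] [/val_inj -> /grid_point_inj ->].
Qed.

Lemma finite_multiscale_index n : finite_set (@multiscale_index_ R d m n).
Proof. by rewrite multiscale_index_E; apply: finite_image; exact: finite_finset. Qed.

Lemma card_multiscale_index n :
  #|` fset_set (@multiscale_index_ R d m n)| =
  (J n * grid_size (@grid_exponent R d m n) ^ d)%N.
Proof.
rewrite multiscale_index_E.
set I : finType := ('I_(J n) * {ffun 'I_d -> 'I_(grid_size (@grid_exponent R d m n))})%type.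
rewrite (_ : range _ = [set` [fset @index_point n p | p in I]%fset]).
  rewrite set_fsetK card_imfset/=; last exact: index_point_inj.
  by rewrite -cardE card_prod card_ffun !card_ord.
apply/seteqP; split => [_ [p _ <-]|w /= /imfsetP[p _ ->]]; last by exists p.
by apply/imfsetP; exists p.
Qed.

Lemma Gamma_ge1 : 1 <= Gamma. Proof. by rewrite le_max lexx. Qed.

Lemma index_count_upper n : (m ^ d <= n)%N ->
  (J n * grid_size (@grid_exponent R d m n) ^ d)%:R <= n%:R `^ (Gamma + 1) :> R.
Proof.
move=> mn; have [J0 /andP[Jn _]] := scale_countP mn.
have G0 : 0 <= Gamma by apply: le_trans Gamma_ge1.
rewrite powRD; last first.
  apply/implyP => _; rewrite pnatr_eq0 -lt0n.
  by rewrite (leq_trans _ mn)// expn_gt0 (leq_trans _ m2).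
rewrite powRr1// mulrC natrM; apply: ler_pM => //.
  rewrite ler_nat; apply: (leq_trans (ltnW (ltn_expl (J n) m2))).
  rewrite -(ler_nat R) natrX (le_trans _ Jn)// ler_weXn2l ?ltW//.
  exact: leq_pmulr.
have JE : (M `^ (@grid_exponent R d m n)) ^+ d = (M ^+ (J n * d)) `^ Gamma.
  rewrite -powR_mulrn ?powR_ge0// -powRrM -powR_mulrn ?ltW// -powRrM /grid_exponent.
  by rewrite natrM; congr (_ `^ _); ring.
rewrite natrX; apply: (@le_trans _ _ ((M `^ (@grid_exponent R d m n)) ^+ d)).
  by rewrite lerXn2r ?nnegrE ?powR_ge0// truncn_le powR_ge0.
by rewrite JE ge0_ler_powR// nnegrE ?exprn_ge0// ltW.
Qed.

(** The integer part of a number that is at least one is at least half of it,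
    and [m ^ (J d)] exceeds [n / m ^ d]. *)
Lemma index_count_lower n : (m ^ d <= n)%N ->
  (2 ^- d * (M ^- d) `^ Gamma) * n%:R `^ Gamma <=
  (J n * grid_size (@grid_exponent R d m n) ^ d)%:R :> R.
Proof.
move=> mn; have [J0 /andP[_ Jn]] := scale_countP mn.
have G0 : 0 <= Gamma by apply: le_trans Gamma_ge1.
set P := M `^ (@grid_exponent R d m n).
have P1 : 1 <= P.
  by rewrite -[leLHS](powRr0 M) ler_powR ?(ltW M1)// /grid_exponent mulr_ge0.
have JE : P ^+ d = (M ^+ (J n * d)) `^ Gamma.
  rewrite -powR_mulrn ?powR_ge0// -powRrM -powR_mulrn ?ltW// -powRrM /grid_exponent.
  by rewrite natrM; congr (_ `^ _); ring.
apply: (@le_trans _ _ ((P / 2) ^+ d)).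
  rewrite exprMn exprVn JE -mulrA [leRHS]mulrC ler_wpM2l//.
  rewrite -powRM ?invr_ge0 ?exprn_ge0 ?(ltW M0)// ge0_ler_powR//.
  - by rewrite nnegrE mulr_ge0// invr_ge0 exprn_ge0// ltW.
  - by rewrite nnegrE exprn_ge0// ltW.
  rewrite mulrC ler_pdivrMr ?exprn_gt0// -exprD (le_trans (ltW Jn))//.
  by rewrite mulSn addnC.
rewrite natrM natrX -[leLHS]mul1r; apply: ler_pM => //.
- by rewrite exprn_ge0// divr_ge0// powR_ge0.
- by rewrite ler1n.
rewrite lerXn2r ?nnegrE ?divr_ge0 ?powR_ge0//.
have p1 : 1 <= (grid_size (@grid_exponent R d m n))%:R :> R.
  by rewrite ler1n truncn_gt0.
rewrite ler_pdivrMr// mulr_natr mulr2n (le_trans (ltW (truncnS_gt P)))//.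
by rewrite -natr1 lerD2l.
Qed.

End grids.

(** * From all positions to the grid *)

Section sup_over_grid.
Context {R : realType} (d m : nat).
Implicit Types (x y z : 'rV[R]_d) (g : 'rV[R]_d -> R).
Variable K : 'rV[R]_d -> R.
Hypothesis mK : multiscale_kernel K.
Hypothesis m2 : (2 <= m)%N.
Hypothesis d1 : (1 <= d)%N.
Local Notation M := (m%:R : R).
Local Notation J := (@scale_count R d m).
Local Notation ah := (@atom_height R d m).

Let M0 : 0 < M. Proof. by rewrite ltr0n (leq_trans _ m2). Qed.
Let M1 : 1 < M. Proof. by rewrite ltr1n. Qed.

(** The inequality of exponents [j (1 - d / 2) + J d / 2 <= J max (1, d / 2)]
    for [j <= J]: for [d <= 2] it is [j <= J] times a nonnegative factor, and
    otherwise the term in [j] is nonpositive. *)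
Lemma grid_error j n : (j < J n)%N ->
  (ah j)^-1 * (M ^+ j * M `^ (- @grid_exponent R d m n)) <= (ah (J n))^-1.
Proof.
move=> jJ; rewrite /atom_height -!powRN -powR_mulrn ?(ltW M0)//.
rewrite -!powRD; try by apply/implyP => _; rewrite gt_eqF.
apply: ler_powR; first exact: ltW.
rewrite /grid_exponent; have jJ' : j%:R <= (J n)%:R :> R by rewrite ler_nat ltnW.
set G := Num.max _ _.
have [d2|d2] := leP (d%:R / 2 : R) 1.
  have -> : G = 1 by rewrite /G; exact/max_idPl.
  have : 0 <= ((J n)%:R - j%:R) * (1 - d%:R / 2) :> R.
    by rewrite mulr_ge0// subr_ge0.
  lra.
have -> : G = d%:R / 2 by rewrite /G; exact/max_idPr/ltW.
have : 0 <= j%:R * (d%:R / 2 - 1) :> R.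
  by rewrite mulr_ge0// subr_ge0 ltW.
lra.
Qed.

Lemma grid_exponent_ge j n : (j < J n)%N ->
  M ^+ j * M `^ (- @grid_exponent R d m n) <= 1.
Proof.
move=> jJ; rewrite -powR_mulrn ?(ltW M0)// -powRD; last first.
  by apply/implyP => _; rewrite gt_eqF.
rewrite -[leRHS](powRr0 M); apply: ler_powR; first exact: ltW.
have jJ' : j%:R <= (J n)%:R :> R by rewrite ler_nat ltnW.
rewrite subr_le0 (le_trans jJ')// /grid_exponent ler_peMr//.
exact: Gamma_ge1.
Qed.

Lemma scale_count_error n : (m ^ d <= n)%N ->
  (ah (J n))^-1 <= M `^ (d%:R / 2) / Num.sqrt n%:R.
Proof.
move=> mn; have [_ /andP[_ nJ]] := @scale_countP R d m m2 d1 n mn.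
have n0 : 0 < n%:R :> R.
  by rewrite ltr0n (leq_trans _ mn)// expn_gt0 (leq_trans _ m2).
rewrite ler_pdivlMr ?sqrtr_gt0// mulrC ler_pdivrMr ?atom_height_gt0//.
have -> : M `^ (d%:R / 2) * ah (J n) = Num.sqrt (M ^+ ((J n).+1 * d)).
  rewrite /atom_height -powRD; last by apply/implyP => _; rewrite gt_eqF.
  rewrite -powR12_sqrt ?exprn_ge0 ?(ltW M0)// -powR_mulrn ?(ltW M0)//.
  rewrite -powRrM natrM -natr1; congr (_ `^ _).
  by rewrite -!mulrDl; congr (_ / 2); ring.
by rewrite ler_wsqrtr// ltW.
Qed.

(** Reduce the position modulo one, then move it to the nearby grid point. *)
Lemma atom_coef_sup : exists2 C, 0 <= C & forall n, (m ^ d <= n)%N ->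
  forall g N, measurable_fun setT g -> periodic g -> (forall x, `|g x| <= N) ->
  forall j z, (j < J n)%N -> `|atom_coef m K g j z| <=
  \big[Num.max/0%R]_(w <- fset_set (@multiscale_index_ R d m n))
     `|torus_inner (multiscale_atom m K w) g| + C * N * (ah (J n))^-1.
Proof.
have [B B0 KB] := kernel_L1_Lipschitz mK.
exists (2 * B); first by rewrite mulr_ge0.
move=> n mn g N mg pg gN j z jJ.
have N0 : 0 <= N by apply: le_trans (gN 0).
pose z' := z - map_mx intr (floorV z).
have z'01 : unit_cube d z' by apply/unit_cube_floorV.
have -> : atom_coef m K g j z = atom_coef m K g j z'.
  by rewrite -(atom_coef_periodic mK m2 mg pg gN j z' (floorV z)) subrK.
have r0 : 0 <= @grid_exponent R d m n.
  by rewrite /grid_exponent mulr_ge0// (le_trans ler01 (Gamma_ge1 d)).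
have [k gk zk] := grid_dense m2 r0 z'01.
rewrite distrC in zk.
have Mj0 : 0 <= M ^+ j by rewrite exprn_ge0// ltW.
have e1 := grid_exponent_ge jJ.
have e2 := grid_error jJ.
have e3 : M ^+ j * `|k - z'| <= 2 * (M ^+ j * M `^ (- @grid_exponent R d m n)).
  by rewrite mulrCA ler_wpM2l.
(* The displacement is at most two in units of the support of the
atom, where the Lipschitz estimate of [K] applies. *)
have e4 : M ^+ j * `|k - z'| <= 2.
  by rewrite (le_trans e3)// ler_piMr.
have D := atom_coef_translate mK m2 mg pg gN B0 KB e4.
rewrite -[atom_coef m K g j z'](subrK (atom_coef m K g j k)).
rewrite (le_trans (ler_normD _ _))// addrC lerD//.
  apply: (Order.TotalTheory.le_bigmax_seq 0 (j, k) xpredT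
    (fun w => `|torus_inner (multiscale_atom m K w) g|)) => //.
  rewrite in_fset_set; last exact: finite_multiscale_index.
  by rewrite inE.
apply: (le_trans D).
apply: (@le_trans _ _ (N * B * ((ah j)^-1 *
    (2 * (M ^+ j * M `^ (- @grid_exponent R d m n)))))).
  by rewrite ler_wpM2l ?mulr_ge0// ler_wpM2l// invr_ge0 ltW// atom_height_gt0.
have -> : N * B * ((ah j)^-1 * (2 * (M ^+ j * M `^ (- @grid_exponent R d m n)))) =
  2 * B * N * ((ah j)^-1 * (M ^+ j * M `^ (- @grid_exponent R d m n))) by ring.
by rewrite ler_wpM2l ?mulr_ge0.
Qed.

End sup_over_grid.

(** * Elimination of one scale *)

Section elimination.
Context {R : realType} (d m : nat).
Local Notation L := (lebesgue_rV d : {measure set 'rV[R]_d -> \bar R}).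
Implicit Types (x y z : 'rV[R]_d) (F G : 'rV[R]_d -> R).
Variable K : 'rV[R]_d -> R.
Hypothesis mK : multiscale_kernel K.
Hypothesis m2 : (2 <= m)%N.
Local Notation M := (m%:R : R).
Local Notation ah := (@atom_height R d m).
Local Notation kappa := (\int[L]_x K x).
Local Notation norm1 := (`|kappa|^-1 * \int[L]_x `|K x|).
Local Notation T j := (residual (mean_kernel m K j)).

Variables (g w : 'rV[R]_d -> R) (N rho D A : R).
Hypotheses (mg : measurable_fun setT g) (pg : periodic g)
  (gN : forall x, `|g x| <= N).
Hypotheses (rho0 : 0 < rho) (w0 : forall x, 0 <= w x)
  (iw : L.-integrable setT (EFin \o w))
  (wD : forall x y, `|y| <= rho^-1 -> w (x - y) <= D * w x).
Hypotheses (D1 : 1 <= D) (AE : A = 1 + norm1 * D).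
Local Notation W := (\int[L]_x w x).

Let M0 : 0 < M. Proof. by rewrite ltr0n (leq_trans _ m2). Qed.
Let N0 : 0 <= N. Proof. by apply: le_trans (gN 0). Qed.
Let norm10 : 0 <= norm1. Proof. by rewrite mulr_ge0// Rintegral_ge0. Qed.
Let A1 : 1 <= A. Proof. by rewrite AE lerDl mulr_ge0// (le_trans ler01). Qed.
Let W0 : 0 <= W. Proof. exact: Rintegral_ge0. Qed.

Lemma diff_bound_le s c c' F : c <= c' ->
  diff_bound w rho s c F -> diff_bound w rho s c' F.
Proof.
move=> cc bF ys ss ay x; apply: le_trans (bF ys ss ay x) _.
rewrite ler_wpM2r// ler_wpM2r//; apply: prodr_ge0 => y _.
by rewrite mulr_ge0// ltW.
Qed.

Lemma diff_bound0 c F : diff_bound w rho 0 c F -> forall x, `|F x| <= c * w x.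
Proof. by move=> /(_ [::] erefl erefl) h x; have := h x; rewrite big_nil mulr1. Qed.

Lemma diff_bound0_integrable c F : measurable_fun setT F ->
  diff_bound w rho 0 c F -> L.-integrable setT (EFin \o F).
Proof.
move=> mF /diff_bound0 bF.
apply: (le_integrable measurableT _ _ (integrableZl measurableT c iw)).
  exact/measurable_EFinP.
by move=> x _; rewrite /= lee_fin (le_trans (bF x))// ler_norm.
Qed.

Lemma inner_diff_bound0 c F (h : 'rV[R]_d -> R) X : 0 <= c -> measurable_fun setT F ->
  diff_bound w rho 0 c F -> measurable_fun setT h -> (forall x, `|h x| <= X) ->
  `|\int[L]_x (F x * h x)| <= c * W * X.
Proof.
move=> c0 mF bF mh hX.
have iF := diff_bound0_integrable mF bF.
have i1 := integrableM_bounded iF mh hX.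
apply: le_trans (le_normr_Rintegral measurableT i1) _.
rewrite mulrAC -RintegralZl//; apply: le_Rintegral => //.
- exact: integrable_norm i1.
- exact: (integrableZl measurableT (c * X) iw).
move=> x _; rewrite normrM mulrAC ler_pM//; exact: diff_bound0.
Qed.

Section one_scale.
Variables (j : nat) (s : R).
Hypotheses (rhoj : rho <= M ^+ j) (js : forall z, `|atom_coef m K g j z| <= s).

Let supp y : mean_kernel m K j y != 0 -> `|y| <= rho^-1.
Proof.
move=> /(mean_kernel_supp mK m2) h; apply: (le_trans h).
by rewrite lef_pV2// posrE exprn_gt0.
Qed.

Let ik := mean_kernel_integrable mK m2 j.

Lemma residual_bound t c F : 0 <= c -> bounded_measurable F ->
  diff_bound w rho t c F -> diff_bound w rho t (c * A) (T j F).
Proof.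
move=> c0 bF bd.
have := diff_bound_residual ik rho0 wD c0 bF supp bd.
by rewrite mean_kernel_norm1// AE.
Qed.

Lemma residual_gain t c F : 0 <= c -> bounded_measurable F ->
  diff_bound w rho t.+1 c F ->
  diff_bound w rho t (c * (A * (rho / M ^+ j))) (T j F).
Proof.
move=> c0 bF bd.
have kd y : mean_kernel m K j y != 0 -> `|y| <= (M ^+ j)^-1.
  exact: mean_kernel_supp.
have dr : (M ^+ j)^-1 <= rho^-1 by rewrite lef_pV2// posrE exprn_gt0.
have := diff_bound_residual_gain ik (mean_kernel_mean mK m2 j) rho0 w0 c0 bF dr kd bd.
rewrite mean_kernel_norm1//; apply: diff_bound_le.
rewrite ler_wpM2l// ler_wpM2r//; first by rewrite divr_ge0 ?exprn_ge0// ltW.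
by rewrite AE -[leLHS]add0r lerD// ler_peMr.
Qed.

(** Split [F] into its convolution and its residual; the convolution is
    paired with [g] by duality. *)
Lemma inner_residual c F : 0 <= c -> bounded_measurable F ->
  diff_bound w rho 0 c F ->
  `|\int[L]_x (F x * g x)| <=
  c * W * (`|kappa|^-1 * ah j * s) + `|\int[L]_x (T j F x * g x)|.
Proof.
move=> c0 bF bd; have [mF _] := bF.
have iF := diff_bound0_integrable mF bd.
have bT := bounded_measurable_residual ik bF.
have iT := diff_bound0_integrable bT.1 (residual_bound c0 bF bd).
have iC : L.-integrable setT (EFin \o convolve (mean_kernel m K j) F).
  have := integrableB measurableT iF iT; apply: eq_integrable => // x _ /=.
  by rewrite -EFinB /residual opprB addrC subrK.
have -> : \int[L]_x (F x * g x) =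
   \int[L]_x (convolve (mean_kernel m K j) F x * g x) + \int[L]_x (T j F x * g x).
  rewrite -RintegralD//.
  - by apply: eq_Rintegral => x _; rewrite -mulrDl /residual addrC subrK.
  - exact: integrableM_bounded iC mg gN.
  - exact: integrableM_bounded iT mg gN.
rewrite (le_trans (ler_normD _ _))// lerD//.
rewrite (inner_convolve ik iF bF mg gN).
have mh : measurable_fun setT
    (fun z => \int[L]_y (mean_kernel m K j y * g (z + y))).
  apply: (@measurable_Rintegral_fubini _ _ _ _ _ (lebesgue_rV d)
    (fun p : 'rV[R]_d * 'rV[R]_d => mean_kernel m K j p.2 * g (p.1 + p.2))).
  have /integrableP[/measurable_EFinP mk _] := ik.
  apply: measurable_funM; first exact: measurableT_comp.
  by apply: (measurableT_comp mg); apply: measurable_addrV.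
apply: inner_diff_bound0 => // z.
rewrite (mean_kernel_coef mK m2 mg pg gN) !normrM normfV.
by rewrite (gtr0_norm (atom_height_gt0 _ m2 _)) ler_wpM2l ?mulr_ge0 ?invr_ge0 ?powR_ge0.
Qed.

Lemma inner_residuals t c F : 0 <= c -> bounded_measurable F ->
  diff_bound w rho 0 c F ->
  [/\ bounded_measurable (iter t (T j) F),
      diff_bound w rho 0 (c * A ^+ t) (iter t (T j) F) &
   `|\int[L]_x (F x * g x)| <=
    t%:R * (c * A ^+ t * W * (`|kappa|^-1 * ah j * s)) +
    `|\int[L]_x (iter t (T j) F x * g x)| ].
Proof.
move=> c0 bF bd; have s0 : 0 <= s by apply: le_trans (js 0).
elim: t => [|t [bI dI leI]].
  by split => //; rewrite ?expr0 ?mulr1// mul0r add0r.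
have cA : 0 <= c * A ^+ t by rewrite mulr_ge0// exprn_ge0// (le_trans ler01).
split; first exact: bounded_measurable_residual.
  by rewrite exprSr mulrA; exact: residual_bound.
apply: (le_trans leI).
apply: (le_trans (lerD (lexx _) (inner_residual cA bI dI))).
rewrite addrA lerD//.
set X := `|kappa|^-1 * _ * s.
have X0 : 0 <= X by rewrite /X !mulr_ge0 ?invr_ge0// powR_ge0.
rewrite -natr1 mulrDl mul1r.
have q : c * A ^+ t * W * X <= c * A ^+ t.+1 * W * X.
  by rewrite ler_wpM2r// ler_wpM2r// ler_wpM2l// ler_weXn2l.
by rewrite lerD// ler_wpM2l.
Qed.

(** All the smoothness can be traded for decay, one order for each residual;
    in parallel the smoothness of order [S] itself survives, with a worse constant. *)
Lemma residuals_gain S t c F : 0 <= c -> bounded_measurable F ->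
  diff_bound w rho S c F -> (t <= S)%N ->
  diff_bound w rho (S - t) (c * (A * (rho / M ^+ j)) ^+ t) (iter t (T j) F) /\
  diff_bound w rho S (c * A ^+ t) (iter t (T j) F).
Proof.
move=> c0 bF bd; elim: t => [|t IH] tS.
  by rewrite subn0 !expr0 !mulr1.
have [h1 h2] := IH (ltnW tS).
have bI : bounded_measurable (iter t (T j) F).
  by elim: (t) => //= u; exact: bounded_measurable_residual.
have A0 : 0 <= A by apply: le_trans A1.
split; rewrite exprSr [c * _]mulrA /=.
  apply: residual_gain => //.
    by rewrite mulr_ge0// exprn_ge0// mulr_ge0// divr_ge0 ?exprn_ge0// ltW.
  by rewrite -subSn// subSS.
by apply: residual_bound => //; rewrite mulr_ge0// exprn_ge0.
Qed.

End one_scale.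

End elimination.

(** * Summation over the scales *)

(** With [r = m ^ j / rho], the exponent [d / 2 - S] is at most [- 1 / 2], and
    the square root of [(4 A ^ (2 S)) ^ l] is [2 ^ l A ^ (S l)]: half of the
    gain cancels the loss [A ^ (S l)] and the other half leaves [2 ^ - l]. *)
Lemma scale_decay {R : realType} (A r : R) (S d l : nat) :
  1 <= A -> (d < 2 * S)%N -> (4 * A ^+ (2 * S)) ^+ l <= r ->
  A ^+ (S * l) * (r^-1 ^+ S * r `^ (d%:R / 2)) <= 2^-1 ^+ l.
Proof.
move=> A1 dS rl; have A0 : 0 < A by apply: lt_le_trans A1.
set B := 4 * A ^+ (2 * S) in rl.
have B1 : 1 <= B.
  by rewrite /B -[leLHS]mulr1 ler_pM// ?exprn_ege1// ler1n.
have r1 : 1 <= r by apply: le_trans rl; rewrite exprn_ege1.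
have r0 : 0 < r by apply: lt_le_trans r1.
have -> : r^-1 ^+ S * r `^ (d%:R / 2) = r `^ (d%:R / 2 - S%:R).
  rewrite powRD; last by apply/implyP => _; rewrite gt_eqF.
  by rewrite powRN powR_mulrn ?ltW// mulrC exprVn.
have h1 : r `^ (d%:R / 2 - S%:R) <= r `^ (- 2^-1).
  apply: ler_powR => //.
  have : d%:R + 1 <= 2 * S%:R :> R by rewrite natr1 -natrM ler_nat.
  lra.
have BE : B ^+ l = (2 ^+ l * A ^+ (S * l)) ^+ 2.
  have -> : B = 2 ^+ 2 * A ^+ (2 * S) by rewrite /B; congr (_ * _); ring.
  rewrite !exprMn -!exprM.
  by rewrite -exprD addnn -muln2 -mulnA [(2 * (S * l))%N]mulnC.
have X0 : 0 < 2 ^+ l * A ^+ (S * l) by rewrite mulr_gt0 ?exprn_gt0.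
have h2 : r `^ (- 2^-1) <= (2 ^+ l * A ^+ (S * l))^-1.
  rewrite powRN lef_pV2 ?posrE ?powR_gt0//.
  have -> : 2 ^+ l * A ^+ (S * l) = (B ^+ l) `^ (2^-1).
    by rewrite BE powR12_sqrt ?sqr_ge0// sqrtr_sqr gtr0_norm.
  rewrite ge0_ler_powR// ?nnegrE ?(ltW r0)// exprn_ge0//.
  exact: le_trans B1.
apply: le_trans (_ : A ^+ (S * l) * (2 ^+ l * A ^+ (S * l))^-1 <= _).
  by rewrite ler_wpM2l ?exprn_ge0 ?(ltW A0)// (le_trans h1).
rewrite invfM mulrCA divff ?mulr1 ?exprVn//.
by rewrite expf_neq0// gt_eqF.
Qed.

Lemma sum_half_le (R : realType) n : \sum_(l < n) (2^-1 : R) ^+ l <= 2.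
Proof.
suff -> : \sum_(l < n) (2^-1 : R) ^+ l = 2 - 2 * 2^-1 ^+ n.
  by rewrite gerBl mulr_ge0// exprn_ge0// invr_ge0.
elim: n => [|n IH]; first by rewrite big_ord0 expr0; ring.
by rewrite big_ord_recr/= IH exprS; field.
Qed.

Section coefficient_bound.
Context {R : realType} (d m : nat).
Local Notation L := (lebesgue_rV d : {measure set 'rV[R]_d -> \bar R}).
Implicit Types (x y z : 'rV[R]_d) (F G : 'rV[R]_d -> R).
Variable K : 'rV[R]_d -> R.
Hypothesis mK : multiscale_kernel K.
Hypothesis m2 : (2 <= m)%N.
Local Notation M := (m%:R : R).
Local Notation ah := (@atom_height R d m).
Local Notation kappa := (\int[L]_x K x).
Local Notation norm1 := (`|kappa|^-1 * \int[L]_x `|K x|).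

Variables (g w F : 'rV[R]_d -> R) (N rho D A : R).
Hypotheses (mg : measurable_fun setT g) (pg : periodic g)
  (gN : forall x, `|g x| <= N).
Hypotheses (rho0 : 0 < rho) (w0 : forall x, 0 <= w x)
  (iw : L.-integrable setT (EFin \o w))
  (wD : forall x y, `|y| <= rho^-1 -> w (x - y) <= D * w x).
Hypotheses (D1 : 1 <= D) (AE : A = 1 + norm1 * D).
Local Notation W := (\int[L]_x w x).

Variables (S q j0 : nat) (c s : R).
Hypotheses (c0 : 0 <= c) (s0 : 0 <= s) (bF : bounded_measurable F)
  (bS : diff_bound w rho S c F) (b0 : diff_bound w rho 0 c F)
  (rhoj : rho <= M ^+ j0) (jrho : M ^+ j0 <= M * rho).

(** Bounds the size of what is left of [F] after [l] blocks of [S] residuals.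
    The last of these blocks works at the scale of index [l - 1]; the factor
    [m ^ q] expresses its gain through the scale of index [l], and one further
    factor [m] makes the formula valid for [l = 0]. *)
Definition scale_bound (l : nat) : R :=
  A ^+ (S * l) * (M ^+ q.+1 * A * (rho / M ^+ (j0 + q * l))) ^+ S.

Let M0 : 0 < M. Proof. by rewrite ltr0n (leq_trans _ m2). Qed.
Let M1 : 1 <= M. Proof. by rewrite ler1n (leq_trans _ m2). Qed.
Let N0 : 0 <= N. Proof. by apply: le_trans (gN 0). Qed.
Let norm10 : 0 <= norm1. Proof. by rewrite mulr_ge0// Rintegral_ge0. Qed.
Let A1 : 1 <= A. Proof. by rewrite AE lerDl mulr_ge0// (le_trans ler01). Qed.
Let A0 : 0 <= A. Proof. exact: le_trans A1. Qed.
Let W0 : 0 <= W. Proof. exact: Rintegral_ge0. Qed.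
Let Mj0 j : 0 < M ^+ j. Proof. by rewrite exprn_gt0. Qed.

Lemma scale_bound_ge0 l : 0 <= scale_bound l.
Proof.
rewrite /scale_bound mulr_ge0 ?exprn_ge0// mulr_ge0//; last by rewrite divr_ge0 ?ltW.
by rewrite mulr_ge0// ltW.
Qed.

Lemma scale_bound0 : 1 <= scale_bound 0.
Proof.
rewrite /scale_bound muln0 expr0 mul1r muln0 addn0 exprn_ege1//.
rewrite mulrA ler_pdivlMr// mul1r (le_trans jrho)// exprS -!mulrA ler_wpM2l ?(ltW M0)//.
rewrite mulrA -[leLHS]mul1r ler_wpM2r ?(ltW rho0)//.
by rewrite -[leLHS]mulr1 ler_pM// exprn_ege1.
Qed.

Lemma scale_boundS l :
  A ^+ (S * l) * (A * (rho / M ^+ (j0 + q * l))) ^+ S <= scale_bound l.+1.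
Proof.
have aE : M ^+ (j0 + q * l.+1) = M ^+ (j0 + q * l) * M ^+ q.
  by rewrite mulnSr addnA exprD.
rewrite /scale_bound aE.
have -> : M ^+ q.+1 * A * (rho / (M ^+ (j0 + q * l) * M ^+ q)) =
    M * (A * (rho / M ^+ (j0 + q * l))).
  rewrite exprS; field; rewrite !gt_eqF//.
have X0 : 0 <= A * (rho / M ^+ (j0 + q * l)).
  by rewrite mulr_ge0// divr_ge0 ?ltW.
rewrite ler_pM ?exprn_ge0//.
  by rewrite ler_weXn2l// mulnS leq_addl.
have X1 := mulr_ge0 (ltW M0) X0.
by rewrite lerXn2r ?nnegrE// -[leLHS]mul1r ler_wpM2r.
Qed.

(** Each block contributes a term controlled by the atoms of its scale. *)
Lemma iterate_scales nb :
  (forall l, (l < nb)%N -> forall z, `|atom_coef m K g (j0 + q * l) z| <= s) ->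
  exists G, [/\ bounded_measurable G, diff_bound w rho S (c * A ^+ (S * nb)) G,
    diff_bound w rho 0 (c * scale_bound nb) G &
    `|\int[L]_x (F x * g x)| <=
    \sum_(l < nb) S%:R * (c * scale_bound l * A ^+ S * W *
       (`|kappa|^-1 * ah (j0 + q * l) * s)) + `|\int[L]_x (G x * g x)| ].
Proof.
elim: nb => [_|nb IH sb].
  exists F; split => //; first by rewrite muln0 expr0 mulr1.
    by apply: (diff_bound_le rho0 w0 _ b0); rewrite ler_peMr// scale_bound0.
  by rewrite big_ord0 add0r.
have [G [bG GS G0 leG]] := IH (fun l lnb => sb l (leqW lnb)).
have rj : rho <= M ^+ (j0 + q * nb).
  by rewrite (le_trans rhoj)// ler_weXn2l// leq_addr.
have js := sb nb (leqnn _).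
have cg : 0 <= c * scale_bound nb by rewrite mulr_ge0// scale_bound_ge0.
have cA : 0 <= c * A ^+ (S * nb) by rewrite mulr_ge0// exprn_ge0.
have [bI _ leI] := inner_residuals mK m2 mg pg gN rho0 w0 iw wD D1 AE rj js S cg bG G0.
have [h1 h2] := residuals_gain mK m2 rho0 w0 wD D1 AE rj cA bG GS (leqnn S).
exists (iter S (residual (mean_kernel m K (j0 + q * nb))) G); split => //.
- by rewrite mulnS [X in A ^+ X]addnC exprD mulrA.
- rewrite subnn in h1; apply: (diff_bound_le rho0 w0 _ h1).
  by rewrite -mulrA ler_wpM2l// scale_boundS.
rewrite big_ord_recr/= -addrA; apply: (le_trans leG).
by rewrite lerD.
Qed.

Variables (c1 W1 : R) (J : nat).
Hypotheses (c10 : 0 <= c1) (W10 : 0 <= W1) (cE : c = c1 * rho `^ (d%:R / 2))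
  (WE : W = W1 / rho ^+ d) (qA : 4 * A ^+ (2 * S) <= M ^+ q) (dS : (d < 2 * S)%N)
  (Js : forall j, (j < J)%N -> forall z, `|atom_coef m K g j z| <= s).

Let const := c1 * W1 * (M ^+ q.+1 * A) ^+ S.

Let const_ge0 : 0 <= const.
Proof. by rewrite !mulr_ge0// exprn_ge0// mulr_ge0// ltW. Qed.

(** Here the dimension enters: the height of the atoms grows like
    [m ^ (j d / 2)], while the wavelet has height [rho ^ (d / 2)] and volume
    [rho ^ - d]. *)
Lemma scale_bound_height l : c * scale_bound l * W * ah (j0 + q * l) <= const * 2^-1 ^+ l.
Proof.
set a := M ^+ (j0 + q * l).
have a0 : 0 < a by exact: Mj0.
have ahE : ah (j0 + q * l) = a `^ (d%:R / 2).
  rewrite /atom_height /a -powR_mulrn ?(ltW M0)// -powRrM.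
  by congr (_ `^ _); ring.
have rr : rho `^ (d%:R / 2) ^+ 2 = rho ^+ d.
  rewrite -powR_mulrn ?powR_ge0// -powRrM -powR_mulrn ?(ltW rho0)//.
  by congr (_ `^ _); field.
have rarho : a `^ (d%:R / 2) = (a / rho) `^ (d%:R / 2) * rho `^ (d%:R / 2).
  by rewrite -powRM ?divr_ge0 ?ltW// divfK// gt_eqF.
have h : A ^+ (S * l) * ((a / rho)^-1 ^+ S * (a / rho) `^ (d%:R / 2)) <= 2^-1 ^+ l.
  apply: scale_decay => //.
  apply: (@le_trans _ _ ((M ^+ q) ^+ l)).
    rewrite lerXn2r ?nnegrE ?mulr_ge0 ?exprn_ge0//; exact: ltW.
  rewrite -exprM ler_pdivlMr// /a exprD mulrC ler_wpM2r// ltW//.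
apply: le_trans (ler_wpM2l const_ge0 h).
rewrite le_eqVlt; apply/orP; left; apply/eqP.
rewrite cE WE ahE rarho /scale_bound /const -/a -rr [in RHS]invf_div !exprMn.
have p0 : rho `^ (d%:R / 2) != 0 by rewrite gt_eqF// powR_gt0.
by field; rewrite ?p0.
Qed.

(** The sum over the scales below [J] is geometric, and the first scale [j0 +
    q nb] beyond [J] bounds the remainder. *)
Lemma coefficient_bound :
  `|\int[L]_x (F x * g x)| <=
  (2 * S%:R * A ^+ S * `|kappa|^-1 * const) * s + const * (N * (ah J)^-1).
Proof.
have q0 : (0 < q)%N.
  rewrite lt0n; apply/eqP => q0; move: qA; rewrite q0 expr0.
  have : 1 <= A ^+ (2 * S) by rewrite exprn_ege1.
  lra.
have ex : exists nb, (J <= j0 + q * nb)%N.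
  by exists J; rewrite (leq_trans _ (leq_addl _ _))// leq_pmull.
(* The number of blocks: all scales used are below [J], as only those
atoms are controlled. It is zero when the wavelet is finer than
the scale [J]. *)
case: (ex_minnP ex) => nb Jnb nbmin.
have lJ l : (l < nb)%N -> (j0 + q * l < J)%N.
  by move=> lnb; rewrite ltnNge; apply: contraL lnb => /nbmin; rewrite -leqNgt.
have [G [bG _ G0 leG]] := iterate_scales (fun l lnb => Js (lJ l lnb)).
apply: (le_trans leG); rewrite lerD//.
  apply: (@le_trans _ _ (\sum_(l < nb)
      (S%:R * A ^+ S * `|kappa|^-1 * const * s) * 2^-1 ^+ l)).
    apply: ler_sum => l _.
    have -> : S%:R * (c * scale_bound l * A ^+ S * W * (`|kappa|^-1 * ah (j0 + q * l) * s)) =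
      (S%:R * A ^+ S * `|kappa|^-1 * s) * (c * scale_bound l * W * ah (j0 + q * l)) by ring.
    rewrite [leRHS](_ : _ =
      (S%:R * A ^+ S * `|kappa|^-1 * s) * (const * 2^-1 ^+ l)); last by ring.
    by rewrite ler_wpM2l ?scale_bound_height// !mulr_ge0 ?invr_ge0 ?exprn_ge0.
  rewrite -mulr_sumr.
  have X0 : 0 <= S%:R * A ^+ S * `|kappa|^-1 * const * s.
    apply: mulr_ge0 => //; apply: mulr_ge0 => //.
    by rewrite !mulr_ge0 ?invr_ge0 ?exprn_ge0.
  apply: le_trans (ler_wpM2l X0 (sum_half_le R nb)) _.
  by rewrite le_eqVlt; apply/orP; left; apply/eqP; ring.
have cg : 0 <= c * scale_bound nb by rewrite mulr_ge0// scale_bound_ge0.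
apply: (le_trans (inner_diff_bound0 iw cg bG.1 G0 mg gN)).
have ahnb := atom_height_gt0 d m2 (j0 + q * nb) : 0 < ah (j0 + q * nb).
have ahJ := atom_height_gt0 d m2 J : 0 < ah J.
rewrite mulrC [leRHS]mulrCA ler_wpM2l//.
have := scale_bound_height nb; rewrite -ler_pdivlMr//.
move/le_trans; apply; rewrite -mulrA ler_wpM2l//.
apply: (@le_trans _ _ (1 * (ah (j0 + q * nb))^-1)).
  by rewrite ler_wpM2r ?invr_ge0 ?(ltW ahnb)// exprn_ile1// ?invr_ge0// invf_le1// ler1n.
rewrite mul1r lef_pV2 ?posrE// /atom_height ler_powR//.
by rewrite ler_wpM2r// ler_wpM2r// ler_nat.
Qed.

End coefficient_bound.

(** * Wavelet coefficients and the Besov norm *)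

Section essential_bound.
Context {R : realType} (d : nat).
Local Notation T := (torus_measure d : {measure set 'rV[R]_d -> \bar R}).
Implicit Types (x y z : 'rV[R]_d) (f g : 'rV[R]_d -> R).

(** A version of [g] that is bounded everywhere and not only almost
    everywhere; cutting off by its own values keeps it periodic. *)
Definition truncation (N : R) g x := if `|g x| <= N then g x else 0.

Lemma torus_norm_oo_fin g : torus_Lp +oo%E g ->
  torus_norm +oo%E g = (fine (torus_norm +oo%E g))%:E.
Proof.
move=> [_]; rewrite inE => /andP[_]; rewrite inE /= => h.
by rewrite fineK// ge0_fin_numE// Lnorm_ge0.
Qed.

Lemma truncationP g : torus_Lp +oo%E g ->
  let N := fine (torus_norm +oo%E g) in
  [/\ measurable_fun setT (truncation N g), periodic (truncation N g),
      forall x, `|truncation N g x| <= N &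
      forall f, measurable_fun setT f ->
        torus_inner f g = torus_inner f (truncation N g) ].
Proof.
move=> gLp N; have NE := torus_norm_oo_fin gLp; rewrite -/N in NE.
have N0 : 0 <= N by rewrite -lee_fin -NE Lnorm_ge0.
have [pg gL] := gLp.
have mg : measurable_fun setT g by move: gL; rewrite inE => /andP[]; rewrite inE.
have mt : measurable_fun setT (truncation N g).
  apply: measurable_fun_ifT => //.
  by apply: measurable_fun_ler => //; exact: measurableT_comp.
split => //.
- by move=> l x; rewrite /truncation pg.
- by move=> x; rewrite /truncation; case: ifPn => //; rewrite normr0.
move=> f mf; rewrite /torus_inner /Rintegral; congr fine.
apply: ae_eq_integral => //.
- by apply/measurable_EFinP; exact: measurable_funM.
- by apply/measurable_EFinP; exact: measurable_funM.
have gN : {ae T, forall x, (`|g x|%:E <= N%:E)%E}.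
  have := NE; rewrite /torus_norm unlock; case: ifPn => [_ E|T0 _].
    by rewrite -E; exact: ess_sup_ge.
  exists setT; split => //.
  by apply/eqP; rewrite eq_le measure_ge0 andbT leNgt.
apply: filterS gN => x gxN _.
by rewrite /truncation -lee_fin gxN.
Qed.

End essential_bound.

Section wavelets.
Context {R : realType} (d : nat).
Local Notation L := (lebesgue_rV d : {measure set 'rV[R]_d -> \bar R}).
Implicit Types (x y z : 'rV[R]_d).

Lemma Cr_rapid_decay_measurable r (f : R -> R) : (0 < r)%N ->
  Cr_rapid_decay r f -> measurable_fun setT f.
Proof.
move=> r0 [df _ _]; apply: continuous_measurable_fun => x.
by apply: differentiable_continuous; apply/derivable1_diffP; exact: (df 0 x r0).
Qed.

Lemma weight_le1 x : weight x <= 1.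
Proof.
rewrite /weight; apply: prodr_ile1 => i _.
rewrite (ltW (cauchy_weight_gt0 _))/= /cauchy_weight invf_le1; last first.
  by rewrite ltr_pwDl// sqr_ge0.
by rewrite lerDl sqr_ge0.
Qed.

(** The wavelet before periodization. *)
Definition line_wavelet_tensor (phi psi : R -> R)
    (v : nat * {ffun 'I_d -> nat} * {ffun 'I_d -> bool}) : 'rV[R]_d -> R :=
  let: (j, k, e) := v in fun x => 2 `^ (j%:R * d%:R / 2) *
    \prod_(i < d) (if e i then psi else phi) (2 ^+ j * x ord0 i - (k i)%:R).

Lemma torus_waveletE phi psi v :
  torus_wavelet phi psi v = periodize (line_wavelet_tensor phi psi v).
Proof. by case: v => [[j k] e]. Qed.

(** The weight adapted to the position and the scale of a wavelet. *)
Definition scaled_weight (v : nat * {ffun 'I_d -> nat} * {ffun 'I_d -> bool}) :=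
  let: (j, k, e) := v in
  fun x : 'rV[R]_d => weight (2 ^+ j *: x - \row_i (k i)%:R).

Lemma line_wavelet_tensor_measurable r phi psi v : (0 < r)%N ->
  Cr_rapid_decay r phi -> Cr_rapid_decay r psi ->
  measurable_fun setT (line_wavelet_tensor phi psi v).
Proof.
case: v => [[j k] e] r0 /(Cr_rapid_decay_measurable r0) mphi
  /(Cr_rapid_decay_measurable r0) mpsi.
apply: measurable_funM => //.
apply: (measurable_tensor (f := fun i t =>
  (if e i then psi else phi) (2 ^+ j * t - (k i)%:R))) => i.
have mf : measurable_fun setT (if e i then psi else phi) by case: (e i).
apply: (measurableT_comp mf); apply: measurable_funB => //.
Qed.

Lemma line_wavelet_tensor_diff_bound r c phi psi j k e s : 0 <= c ->
  diff_bounds (@cauchy_weight R) r c phi ->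
  diff_bounds (@cauchy_weight R) r c psi -> (s <= r)%N ->
  diff_bound (scaled_weight (j, k, e)) (2 ^+ j) s
    (((9 ^+ r * c) ^+ d) * (2 ^+ j) `^ (d%:R / 2)) (line_wavelet_tensor phi psi (j, k, e)).
Proof.
move=> c0 bphi bpsi sr.
have bT := diff_bounds_tensor (n := d) (f := fun i => if e i then psi else phi) c0.
have {}bT := bT r (fun i => if e i as b return
  diff_bounds (@cauchy_weight R) r c (if b then psi else phi) then bpsi else bphi) s sr.
have a0 : 0 <= (2 ^+ j : R) `^ (d%:R / 2) by exact: powR_ge0.
have p0 : 0 < 2 ^+ j :> R by rewrite exprn_gt0.
have := diff_bound_rescale (\row_i (k i)%:R) p0 a0 bT.
rewrite mulrC; congr diff_bound; apply/funext => x; rewrite /line_wavelet_tensor.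
congr (_ * _); last by apply: eq_bigr => i _; rewrite !mxE.
by rewrite -powR_mulrn// -powRrM; congr (_ `^ _); ring.
Qed.

Lemma scaled_weight_ge0 v x : 0 <= scaled_weight v x.
Proof. by case: v => [[j k] e]; exact/ltW/weight_gt0. Qed.

Lemma scaled_weight_integrable v : L.-integrable setT (EFin \o scaled_weight v).
Proof.
case: v => [[j k] e].
apply: (integrable_rV_affine (- \row_i (k i)%:R) _ (@integrable_weight R d)).
by rewrite exprn_gt0.
Qed.

Lemma scaled_weight_mean j k e :
  \int[L]_x scaled_weight (j, k, e) x = \int[L]_x (@weight R d x) / (2 ^+ j) ^+ d.
Proof.
rewrite mulrC.
apply: (Rintegral_rV_affine (- \row_i (k i)%:R) _ (@integrable_weight R d)).
by rewrite exprn_gt0.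
Qed.

Lemma scaled_weight_shift j k e x y : `|y| <= (2 ^+ j)^-1 ->
  scaled_weight (j, k, e) (x - y) <= 8 ^+ d * scaled_weight (j, k, e) x.
Proof.
move=> yj; rewrite /scaled_weight scalerBr addrAC.
have -> : (8 : R) = (1 + 1) ^+ 2 * 2 by ring.
apply: weight_shift => //; rewrite normrZ gtr0_norm ?exprn_gt0//.
by rewrite -ler_pdivlMl ?exprn_gt0// mulr1.
Qed.

End wavelets.

(** Take the first power of [M] that is at least [rho]. *)
Lemma exists_scale {R : realType} (M rho : R) : 1 < M -> 1 <= rho ->
  exists j, rho <= M ^+ j /\ M ^+ j <= M * rho.
Proof.
move=> M1 rho1; have M0 : 0 < M by apply: lt_trans M1.
have [j0 hj0] : exists j, rho <= M ^+ j.
  have [j hj] : exists j, rho <= j%:R * (M - 1).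
    exists (Num.bound (rho / (M - 1))).
    rewrite -ler_pdivrMr ?subr_gt0// ltW// archi_boundP//.
    by rewrite divr_ge0 ?subr_ge0 ?(ltW M1)// (le_trans ler01).
  exists j; apply: (le_trans hj).
  (* Bernoulli's inequality shows that the powers of [M] are unbounded. *)
  suff : 1 + j%:R * (M - 1) <= M ^+ j by lra.
  elim: (j) => [|i IH]; first by rewrite mul0r addr0 expr0.
  rewrite exprS -natr1.
  have : 0 <= i%:R * (M - 1) ^+ 2 by rewrite mulr_ge0// sqr_ge0.
  have : M * (1 + i%:R * (M - 1)) <= M * M ^+ i by rewrite ler_wpM2l// ltW.
  lra.
have ex : exists j, rho <= M ^+ j by exists j0.
case: (ex_minnP ex) => j rj jmin; exists j; split => //.
case: j rj jmin => [_ _|j rj jmin].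
  by rewrite expr0 (le_trans rho1)// ler_peMl ?(ltW M1)// (le_trans ler01).
rewrite exprS ler_wpM2l ?(ltW M0)// ltW// ltNge; apply/negP => /jmin.
by rewrite ltnn.
Qed.

Section besov_bound.
Context {R : realType} (d m S : nat) (K : 'rV[R]_d -> R) (phi psi : R -> R).
Local Notation L := (lebesgue_rV d : {measure set 'rV[R]_d -> \bar R}).
Hypotheses (d1 : (1 <= d)%N) (m2 : (2 <= m)%N) (mK : multiscale_kernel K).
Hypotheses (dS : (d < 2 * S)%N) (S0 : (0 < S)%N).
Hypotheses (rphi : Cr_rapid_decay S phi) (rpsi : Cr_rapid_decay S psi).

(** All constants are chosen before [n], [g] and the wavelet: dilation
    invariance of [diff_bound] makes them independent of the scale of the wavelet. *)
Lemma wavelet_coefficient_bound : exists2 C : R, 0 < C &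
  forall n, (m ^ d <= n)%N -> forall g N, measurable_fun setT g -> periodic g ->
  (forall x, `|g x| <= N) -> forall v,
  `|torus_inner (torus_wavelet phi psi v) g| <=
  C * \big[Num.max/0%R]_(w <- fset_set (@multiscale_index_ R d m n))
     `|torus_inner (multiscale_atom m K w) g| + C / Num.sqrt n%:R * N.
Proof.
have M1 : 1 < m%:R :> R by rewrite ltr1n.
have M0 : 0 < m%:R :> R by apply: lt_trans M1.
have [cphi cphi0 bphi] := Cr_rapid_decay_diff_bounds rphi.
have [cpsi cpsi0 bpsi] := Cr_rapid_decay_diff_bounds rpsi.
have mono c c' f : c <= c' -> diff_bounds (@cauchy_weight R) S c f ->
    diff_bounds (@cauchy_weight R) S c' f.
  move=> cc bf s sS; have /diff_bound1 h := bf s sS; apply/diff_bound1.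
  move=> ys ss ay x; apply: (le_trans (h ys ss ay x)).
  rewrite ler_wpM2r ?(ltW (cauchy_weight_gt0 _))// ler_wpM2r//.
  by apply: prodr_ge0.
(* A common constant for both functions, whichever factors occur in the
tensor product. *)
pose c := cphi + cpsi; have c0 : 0 <= c by rewrite addr_ge0.
have {}bphi : diff_bounds (@cauchy_weight R) S c phi.
  by apply: mono bphi; rewrite lerDl.
have {}bpsi : diff_bounds (@cauchy_weight R) S c psi.
  by apply: mono bpsi; rewrite lerDr.
pose kappa := \int[L]_x K x.
pose D : R := 8 ^+ d; have D1 : 1 <= D by rewrite exprn_ege1// ler1n.
pose A := 1 + (`|kappa|^-1 * \int[L]_x `|K x|) * D.
have A1 : 1 <= A.
  by rewrite lerDl !mulr_ge0 ?invr_ge0 ?Rintegral_ge0// (le_trans ler01).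
have [q [qA _]] : exists q, 4 * A ^+ (2 * S) <= m%:R ^+ q /\
    m%:R ^+ q <= m%:R * (4 * A ^+ (2 * S)).
  apply: exists_scale => //.
  by rewrite -[leLHS]mulr1 ler_pM// ?exprn_ege1// ler1n.
have [Cs Cs0 sup] := atom_coef_sup mK m2.
pose c1 := (9 ^+ S * c) ^+ d.
have c10 : 0 <= c1 by rewrite exprn_ge0// mulr_ge0// exprn_ge0.
pose W1 := \int[L]_x (@weight R d x).
have W10 : 0 <= W1 by apply: Rintegral_ge0 => x _; exact/ltW/weight_gt0.
pose C2 := c1 * W1 * (m%:R ^+ q.+1 * A) ^+ S.
have C20 : 0 <= C2.
  rewrite !mulr_ge0// exprn_ge0// mulr_ge0 ?exprn_ge0 ?(ltW M0)//.
  exact: le_trans A1.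
pose C1 := 2 * S%:R * A ^+ S * `|kappa|^-1 * C2.
have C10 : 0 <= C1.
  rewrite /C1 mulr_ge0// mulr_ge0 ?invr_ge0// mulr_ge0 ?mulr_ge0//.
  by rewrite exprn_ge0// (le_trans ler01).
pose h := m%:R `^ (d%:R / 2) : R.
have h0 : 0 <= h by exact: powR_ge0.
pose C3 := (C1 * Cs + C2) * h.
have C30 : 0 <= C3 by rewrite mulr_ge0// addr_ge0// mulr_ge0.
exists (1 + C1 + C3).
  by rewrite -addrA ltr_pwDl// addr_ge0.
move=> n mn g N mg pg gN [[j k] e].
have N0 : 0 <= N by apply: le_trans (gN 0).
set mx := \big[Num.max/0]_(w <- _) _.
have mx0 : 0 <= mx by rewrite /mx; elim/big_ind : _ => // a b a0 b0; rewrite le_max a0.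
pose w := @scaled_weight R d (j, k, e).
pose F := line_wavelet_tensor phi psi (j, k, e).
pose rho : R := 2 ^+ j.
have rho0 : 0 < rho by rewrite exprn_gt0.
have bd s (sS : (s <= S)%N) : diff_bound w rho s (c1 * rho `^ (d%:R / 2)) F.
  exact: (line_wavelet_tensor_diff_bound k e c0 bphi bpsi sS).
have mF : measurable_fun setT F by exact: line_wavelet_tensor_measurable S0 rphi rpsi.
have cc0 : 0 <= c1 * rho `^ (d%:R / 2) by rewrite mulr_ge0// powR_ge0.
have bF : bounded_measurable F.
  split => //; exists (c1 * rho `^ (d%:R / 2)) => x.
  apply: (le_trans (diff_bound0 (bd 0 (leq0n _)) x)).
  by rewrite ler_piMr// weight_le1.
have iw := @scaled_weight_integrable R d (j, k, e).
have iF := diff_bound0_integrable iw mF (bd 0 (leq0n _)).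
rewrite torus_waveletE (torus_inner_periodize iF mg pg gN).
have rho1 : 1 <= rho by rewrite exprn_ege1// ler1n.
have [j0 [rj jr]] := exists_scale M1 rho1.
pose ahJ : R := (atom_height d m (@scale_count R d m n))^-1.
have ahJ0 : 0 <= ahJ by rewrite invr_ge0 powR_ge0.
have s0 : 0 <= mx + Cs * N * ahJ by rewrite addr_ge0// !mulr_ge0.
have main := coefficient_bound mK m2 mg pg gN rho0
  (@scaled_weight_ge0 R d (j, k, e)) iw (@scaled_weight_shift R d j k e) D1 erefl
  cc0 s0 bF (bd S (leqnn S)) (bd 0 (leq0n _)) rj jr c10 W10 erefl
  (scaled_weight_mean j k e) qA dS (fun j jJ z => sup n mn g N mg pg gN j z jJ).
apply: (le_trans main); rewrite -/kappa -/A -/C2 -/C1 -/ahJ.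
have hn := scale_count_error m2 d1 mn : ahJ <= h / Num.sqrt n%:R.
have -> : C1 * (mx + Cs * N * ahJ) + C2 * (N * ahJ) =
  C1 * mx + (C1 * Cs + C2) * ahJ * N by ring.
rewrite lerD//.
  by rewrite ler_wpM2r// -addrA addrCA lerDl addr_ge0.
rewrite ler_wpM2r//.
apply: (@le_trans _ _ (C3 / Num.sqrt n%:R)).
  by rewrite /C3 -mulrA ler_wpM2l// addr_ge0// mulr_ge0.
by rewrite ler_wpM2r ?invr_ge0 ?sqrtr_ge0// lerDr addr_ge0.
Qed.

End besov_bound.

Local Unset Implicit Arguments.

Theorem proposition2 (R : realType) (d m : nat) (K : 'rV[R]_d -> R)
    (S : nat) (phi psi : R -> R) :
  (1 <= d)%N -> (2 <= m)%N -> multiscale_kernel K ->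
  Num.max 1 (d%:R / 2) < S%:R :> R ->
  regular_torus_wavelet_basis d S phi psi ->
  assumptionA (besov_norm phi psi)
    (multiscale_index d m) (m ^ d) (multiscale_index_ d m)
    (multiscale_atom m K)
    (Num.max 1 (d%:R / 2))
    (fun x => x `^ (Num.max 1 (d%:R / 2) + 1)).
Proof.
move=> d1 m2 mK hS [[rphi rpsi _ _] _].
have G1 := @Gamma_ge1 R d.
have S0 : (0 < S)%N.
  by rewrite -(ltr_nat R) (lt_trans _ hS)// (lt_le_trans ltr01).
have dS : (d < 2 * S)%N.
  have := hS; rewrite gt_max => /andP[_].
  by rewrite ltr_pdivrMr// -natrM ltr_nat mulnC.
split.
- apply: bigcup_countable; first exact: countableP.
  by move=> n _; exact/finite_set_countable/finite_multiscale_index.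
- move=> n mn; split; first exact: finite_multiscale_index.
  by move=> w wn; exists n.
- by move=> w _; exact: atom_normalized.
- exact: lt_le_trans G1.
- exists 1, (Num.bound (Num.max 1 (d%:R / 2) + 1 : R)) => x x1.
  rewrite mul1r ger0_norm ?powR_ge0// -powR_mulrn ?(le_trans ler01)//.
  apply: ler_powR => //; apply/ltW/archi_boundP.
  by rewrite addr_ge0// (le_trans ler01).
- exists (2 ^- d * (m%:R ^- d) `^ Num.max 1 (d%:R / 2)).
    by rewrite mulr_gt0// ?powR_gt0 ?invr_gt0 ?exprn_gt0// ltr0n (leq_trans _ m2).
  move=> n mn; rewrite card_multiscale_index//; apply/andP; split.
    exact: index_count_lower.
  exact: index_count_upper.
have [C C0 hC] := wavelet_coefficient_bound d1 m2 mK dS S0 rphi rpsi.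
exists C => // n mn g gLp.
have [mt pt tN tE] := truncationP gLp.
rewrite (torus_norm_oo_fin gLp) -EFinM -EFinD.
apply: ub_ereal_sup => _ [v _ <-]; rewrite lee_fin tE; last first.
  rewrite torus_waveletE; apply: measurable_periodize.
  exact: line_wavelet_tensor_measurable S0 rphi rpsi.
have matom w : measurable_fun setT (multiscale_atom m K w).
  by case: w => j z; apply: measurable_periodize; exact: line_atom_measurable.
under eq_bigr do rewrite tE//.
exact: hC.
Qed.
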